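(* Let $\Sigma^2$ be a smoothly embedded $2$-torus in $\mathbf{S}^3$. Then $$\mathrm{rad}^{\bigodot}(\Sigma)\le\frac{\pi}{4},$$ and equality holds if and only if $\Sigma$ is, up to an isometry of $\mathbf{S}^3$, the Clifford torus $\{(z_1,z_2)\in\mathbb{C}^2 : |z_1|=|z_2|=1/\sqrt{2}\}$.
   Context: $\mathbf{S}^3=\{(z_1,z_2)\in\mathbb{C}^2:|z_1|^2+|z_2|^2=1\}$ is the unit $3$-sphere with its round metric of constant curvature $1$. For a smoothly embedded closed surface $\Sigma\subset\mathbf{S}^3$ with normal bundle $\nu\Sigma$, the focal radius $\mathrm{rad}^{\bigodot}(\Sigma)=\mathrm{rad}^{\bigodot}(\Sigma\subset\mathbf{S}^3)$ is the largest number $r>0$ such that the normal exponential map $$\exp:\{(p,v)\in\nu\Sigma : p\in\Sigma,\ |v|<r\}\to\mathbf{S}^3$$ is a diffeomorphism onto its image. *)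

(* Defs.v *)
From HB Require Import structures.
From mathcomp Require Import all_boot all_order all_algebra.
From mathcomp Require Import all_classical all_reals all_analysis.

Set Implicit Arguments.
Unset Strict Implicit.
Unset Printing Implicit Defensive.

Import Order.TTheory GRing.Theory Num.Theory.
Import numFieldNormedType.Exports.

Local Open Scope classical_set_scope.
Local Open Scope ring_scope.

Section Smooth.
Context {R : realType}.

Fixpoint Ck_on {V W : normedModType R} (k : nat) (U : set V) (f : V -> W)
    : Prop :=
  if k is k'.+1 then
    (forall x, U x -> differentiable f x) /\
    (forall v : V, Ck_on k' U (fun x => 'D_v f x))
  else forall x, U x -> {for x, continuous f}.

(* Meant for open [U]. *)
Definition smooth_on {V W : normedModType R} (U : set V) (f : V -> W) : Prop :=
  forall k, Ck_on k U f.

(* Smoothness of a map defined on an arbitrary subset [A] of a normed space: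
   [f] locally extends to a smooth map on an open set of the ambient space.
   The values of [f] outside [A] are irrelevant. *)
Definition smooth_map {V W : normedModType R} (A : set V) (f : V -> W) : Prop :=
  forall x, A x -> exists (U : set V) (g : V -> W),
    [/\ open U, U x, smooth_on U g & forall y, U y -> A y -> g y = f y].

Definition diffeo_onto_image {V W : normedModType R} (A : set V) (f : V -> W)
    : Prop :=
  smooth_map A f /\
  exists g : W -> V, (forall x, A x -> g (f x) = x) /\ smooth_map (f @` A) g.

End Smooth.

Section Sphere.
Context {R : realType}.

(* The norm of the normed module ['rV[R]_4] is the sup norm, so the Euclidean
   structure is introduced separately; both induce the same topology. *)
Definition dotv (u v : 'rV[R]_4) : R := \sum_(i < 4) u 0 i * v 0 i.

Definition enorm (u : 'rV[R]_4) : R := Num.sqrt (dotv u u).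

(* C^2 is identified with R^4 by
   (z_1, z_2) = (x_0 + i x_1, x_2 + i x_3). *)
Definition rcoord (x : 'rV[R]_4) (k : nat) : R := x 0 (inord k).

Definition znorm1 (x : 'rV[R]_4) : R :=
  Num.sqrt (rcoord x 0 ^+ 2 + rcoord x 1 ^+ 2).

Definition znorm2 (x : 'rV[R]_4) : R :=
  Num.sqrt (rcoord x 2 ^+ 2 + rcoord x 3 ^+ 2).

Definition S3 : set 'rV[R]_4 := [set x | znorm1 x ^+ 2 + znorm2 x ^+ 2 = 1].

Definition clifford_torus : set 'rV[R]_4 :=
  [set x | znorm1 x = (Num.sqrt 2)^-1 /\ znorm2 x = (Num.sqrt 2)^-1].

(* Geodesic distance of the round metric of curvature 1. *)
Definition S3_dist (p q : 'rV[R]_4) : R := acos (dotv p q).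

(* The values of [phi] outside the sphere are irrelevant. *)
Definition S3_isometry (phi : 'rV[R]_4 -> 'rV[R]_4) : Prop :=
  phi @` S3 = S3 /\
  forall p q, S3 p -> S3 q -> S3_dist (phi p) (phi q) = S3_dist p q.

(* [f] is the lift to R^2 of a map defined on the torus R^2 / Z^2: the second
   clause makes this map well defined and injective, the third one makes it an
   immersion.  The torus being compact, an injective immersion is an embedding. *)
Definition torus_embedding (f : 'rV[R]_2 -> 'rV[R]_4) : Prop :=
  [/\ smooth_on setT f,
      forall x y : 'rV[R]_2,
        f x = f y <-> exists k : 'rV[int]_2, y = x + map_mx intr k,
      forall x v : 'rV[R]_2, 'D_v f x = 0 -> v = 0
    & forall x, S3 (f x)].

Definition embedded_torus (Sigma : set 'rV[R]_4) : Prop :=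
  exists f, torus_embedding f /\ range f = Sigma.

(* Velocities at [p] of smooth curves in [Sigma]. *)
Definition tangent_vector (Sigma : set 'rV[R]_4) (p w : 'rV[R]_4) : Prop :=
  exists (e : R) (gamma : R -> 'rV[R]_4),
    [/\ 0 < e, smooth_on `]- e, e[%classic gamma,
        forall t : R, `]- e, e[%classic t -> Sigma (gamma t),
        gamma 0 = p & derive1 gamma 0 = w].

(* The normal bundle of [Sigma] in the sphere: [dotv p v = 0] says that [v] is
   tangent to the sphere at [p]. *)
Definition normal_bundle (Sigma : set 'rV[R]_4)
    : set ('rV[R]_4 * 'rV[R]_4)%type :=
  [set pv | [/\ Sigma pv.1, dotv pv.1 pv.2 = 0
              & forall w, tangent_vector Sigma pv.1 w -> dotv w pv.2 = 0]].

Definition normal_disc_bundle (Sigma : set 'rV[R]_4) (r : R)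
    : set ('rV[R]_4 * 'rV[R]_4)%type :=
  [set pv | normal_bundle Sigma pv /\ enorm pv.2 < r].

(* The exponential map of the sphere; at [v = 0] the second term vanishes. *)
Definition S3_exp (pv : 'rV[R]_4 * 'rV[R]_4) : 'rV[R]_4 :=
  cos (enorm pv.2) *: pv.1 + (sin (enorm pv.2) / enorm pv.2) *: pv.2.

(* The largest admissible radius, taken as a supremum in the extended reals.
   For an embedded closed surface the admissible radii are positive, bounded
   and stable under increasing limits, so the supremum is attained. *)
Definition focal_radius (Sigma : set 'rV[R]_4) : \bar R :=
  ereal_sup [set r%:E | r in
    [set r : R | 0 < r /\
                 diffeo_onto_image (normal_disc_bundle Sigma r) S3_exp]].

End Sphere.

(* Main.v *)
From HB Require Import structures.
Require Import Defs.
From mathcomp Require Import all_boot all_order all_algebra.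
From mathcomp Require Import all_classical all_reals all_analysis.
From mathcomp Require Import ring lra zify.

(** The focal radius controls the curvature, and Gauss-Bonnet controls the
    curvature of a torus.

    Let the normal exponential map be injective on the disc bundle of radius r,
    and let s < r.  The open ball of radius s tangent to the torus at a point
    contains no point of the torus ([empty_tangent_ball]): otherwise the point of
    the torus nearest to the centre would provide a second, shorter, normal
    geodesic to the centre.
    Expanding to second order at the point of tangency, the second fundamental
    form is at most cot s times the first one ([curvature_bound]).  If the focal
    radius is at least pi / 4, the principal curvatures are thus at most 1 in
    absolute value, and the Gauss curvature, 1 plus their product, is
    nonnegative.

    A torus has a global orthonormal tangent frame, obtained by the Gram-Schmidt
    process from the coordinate vectors.  The structure equation
    ([gauss_equation]) presents the curvature, times the area element, as the
    divergence of a periodic vector field, so that its integral vanishes; being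
    nonnegative, it vanishes identically ([periodic_divergence_eq0],
    [gauss_bonnet]).  A radius larger than pi / 4 would make it positive, whence
    the inequality ([focal_le]).  In the case of equality the product of the
    principal curvatures is -1 while both are at most 1 in absolute value: they
    are 1 and -1, and the torus is flat and minimal ([focal_ge_flat_minimal]).

    For a flat minimal surface with position f and unit normal nu, let the
    linear involution M exchange f and nu and act on the tangent plane as the
    differential of nu.  The derivative of M is a totally symmetric cubic form on
    the tangent plane that anticommutes with M, hence vanishes, and M is constant
    ([invol_constant]).  So the torus lies in the quadric <x, M x> = 0 of the
    sphere, and it exhausts that quadric because no point of the quadric outside
    the torus can have a nearest point on it ([quadric_sub_torus]).  In an
    orthonormal basis of eigenvectors of M the quadric is the Clifford torus
    ([torus_clifford]).

    Conversely, an isometry of the sphere is given by the coordinates in an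
    orthonormal basis ([S3_isometry_basis]), so it suffices to treat the set of
    points of the sphere equidistant from two orthogonal great circles.  At
    distance s along the normal, the two components of a point are rescaled by
    cos s + sin s and cos s - sin s; for |s| < pi / 4 both factors are positive,
    and the point and s are recovered smoothly ([equidistant_diffeo]). *)

Set Implicit Arguments.
Unset Strict Implicit.
Unset Printing Implicit Defensive.

Import Order.TTheory GRing.Theory Num.Theory.
Import numFieldNormedType.Exports.

Local Open Scope classical_set_scope.
Local Open Scope ring_scope.

(** * Smooth maps between normed spaces *)

Section SmoothCalculus.
Context {R : realType}.
Implicit Types V W : normedModType R.

(** The difference of the two maps vanishes near the point, so its increments are
    negligible and it is differentiable there. *)
Lemma near_eq_differentiable V W (f g : V -> W) (x : V) :
  (\near x, f x = g x) -> differentiable f x -> differentiable g x.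
Proof.
move=> fg df.
have -> : g = f + (g - f) by apply/funext => y; rewrite !fctE subrKC.
apply: differentiableD => //.
have lo : (g - f) \o shift x = cst ((g - f) x) + (\0 : {linear V -> W}) +o_ 0 id.
  apply/eqaddoP => _ /posnumP[e].
  have gf0 : \forall y \near (0 : V), f (y + x) = g (y + x).
    have := fg; rewrite (near_shift 0) /=.
    by apply: filterS => y; rewrite subr0.
  apply: filterS gf0 => y /= yE; rewrite !fctE /=.
  rewrite -yE (nbhs_singleton fg) !subrr addr0 subr0 normr0.
  by rewrite mulr_ge0.
apply/diff_locallyP; rewrite (diff_unique _ lo).
  by split => // y; exact: cst_continuous.
by move=> y; exact: cst_continuous.
Qed.

(** On an open set, the values of a map determine all its iterated directional
    derivatives. *)
Lemma Ck_on_ext V W (U : set V) k (f g : V -> W) :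
  open U -> (forall x, U x -> f x = g x) -> Ck_on k U f -> Ck_on k U g.
Proof.
move=> oU; elim: k f g => [|k IH] f g fg /=.
  move=> cf x Ux.
  have fgx : \near x, f x = g x by apply: filterS (open_nbhs_nbhs (conj oU Ux)).
  have cfx : f @ x --> g x by rewrite -(fg x Ux); exact: cf.
  by apply: cvg_trans cfx; exact: near_eq_cvg.
move=> [df Df]; split=> [x Ux|v].
  have fgx : \near x, f x = g x by apply: filterS (open_nbhs_nbhs (conj oU Ux)).
  exact: near_eq_differentiable fgx (df x Ux).
apply: IH (Df v) => x Ux; apply: near_eq_derive.
exact: filterS (open_nbhs_nbhs (conj oU Ux)).
Qed.

Lemma Ck_onS V W (U : set V) k (f : V -> W) : Ck_on k.+1 U f -> Ck_on k U f.
Proof.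
elim: k f => [|k IH] f [df Df]; last by split=> // v; exact: IH (Df v).
by move=> x Ux; exact: differentiable_continuous (df x Ux).
Qed.

Lemma Ck_on_sub V W (A U : set V) k (f : V -> W) :
  A `<=` U -> Ck_on k U f -> Ck_on k A f.
Proof.
move=> AU; elim: k f => [|k IH] f /=; first by move=> cf x /AU; exact: cf.
by move=> [df Df]; split=> [x /AU|v]; [exact: df|exact: IH (Df v)].
Qed.

Lemma Ck_on_cst V W (U : set V) k (w : W) : Ck_on k U (fun _ : V => w).
Proof.
elim: k w => [|k IH] w /=; first by move=> x _; exact: cst_continuous.
split=> [x _|v]; first exact: differentiable_cst.
have -> : (fun x => 'D_v (fun _ : V => w) x) = (fun=> 0 : W).
  by apply/funext => x; exact: derive_cst.
exact: IH.
Qed.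

Lemma Ck_onD V W (U : set V) k (f g : V -> W) : open U ->
  Ck_on k U f -> Ck_on k U g -> Ck_on k U (fun x => f x + g x).
Proof.
move=> oU; elim: k f g => [|k IH] f g /=.
  by move=> cf cg x Ux; apply: continuousD; [exact: cf|exact: cg].
move=> [df Df] [dg Dg]; split=> [x Ux|v].
  by apply: differentiableD; [exact: df|exact: dg].
apply: (Ck_on_ext oU) (IH _ _ (Df v) (Dg v)) => x Ux.
by rewrite -deriveD //; apply: diff_derivable; [exact: df|exact: dg].
Qed.

Lemma Ck_on_sum V W (U : set V) k n (f : 'I_n -> V -> W) : open U ->
  (forall i, Ck_on k U (f i)) -> Ck_on k U (fun x => \sum_(i < n) f i x).
Proof.
move=> oU; elim: n f => [|n IH] f Cf.
  have -> : (fun x => \sum_(i < 0) f i x) = (fun=> 0).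
    by apply/funext => x; rewrite big_ord0.
  exact: Ck_on_cst.
under eq_fun do rewrite big_ord_recl.
by apply: Ck_onD => //; exact: IH.
Qed.

(** Induction on the order: in the Leibniz rule each factor is differentiated at
    most once, and an undifferentiated factor of class k + 1 is of class k. *)
Lemma Ck_onM V (U : set V) k (f g : V -> R) : open U ->
  Ck_on k U f -> Ck_on k U g -> Ck_on k U (fun x => f x * g x).
Proof.
move=> oU; elim: k f g => [|k IH] f g.
  by move=> cf cg x Ux; apply: continuousM; [exact: cf|exact: cg].
move=> Cf Cg; have [df Df] := Cf; have [dg Dg] := Cg; split=> [x Ux|v].
  by apply: differentiableM; [exact: df|exact: dg].
have C1 := IH _ _ (Ck_onS Cf) (Dg v); have C2 := IH _ _ (Ck_onS Cg) (Df v).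
apply: (Ck_on_ext oU) (Ck_onD oU C1 C2) => x Ux.
rewrite -[RHS]/('D_v (f * g) x) deriveM //.
- by apply: diff_derivable; exact: df.
- by apply: diff_derivable; exact: dg.
Qed.

Lemma Ck_on_linear V (V' W : normedModType R) (U : set V) k (L : {linear V' -> W})
    (f : V -> V') : open U -> continuous L ->
  Ck_on k U f -> Ck_on k U (fun x => L (f x)).
Proof.
move=> oU cL; elim: k f => [|k IH] f /=.
  by move=> cf x Ux; apply: continuous_comp; [exact: cf|exact: cL].
move=> [df Df]; have dL y := linear_differentiable y cL.
split=> [x Ux|v]; first by apply: differentiable_comp => //; exact: df.
apply: (Ck_on_ext oU) (IH _ (Df v)) => x Ux.
rewrite deriveE; last exact: df.
rewrite deriveE; last by apply: differentiable_comp => //; exact: df.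
rewrite (diff_comp (df x Ux) (dL (f x))) /=.
by rewrite (diff_lin (f x) cL).
Qed.

Lemma Ck_on_id V (U : set V) k : Ck_on k U (fun x : V => x).
Proof.
case: k => [|k] /=; first by move=> x _; exact: cvg_id.
split=> [x _|v]; first exact: ex_diff.
have -> : (fun x : V => 'D_v (fun x => x) x) = (fun=> v).
  by apply/funext => x; exact: derive_id.
exact: Ck_on_cst.
Qed.

Lemma Ck_onZl V W (U : set V) k (f : V -> R) (w : W) : open U ->
  Ck_on k U f -> Ck_on k U (fun x => f x *: w).
Proof.
move=> oU.
have lin : linear (fun a : R => a *: w) by move=> a b c; rewrite scalerDl scalerA.
pose LM := GRing.isLinear.Build _ _ _ _ _ lin.
pose L : {linear R -> W} := HB.pack (fun a : R => a *: w) LM.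
have cL : continuous L by exact: scalel_continuous.
exact: (Ck_on_linear (L := L) oU cL).
Qed.

Lemma Ck_on_coord V (U : set V) k n (f : V -> 'rV[R]_n) i : open U ->
  Ck_on k U f -> Ck_on k U (fun x => f x 0 i).
Proof.
move=> oU.
have @L : {linear 'rV[R]_n -> R}.
  by exists (fun N : 'rV[R]_n => N 0 i); do 2![eexists]; do ?[constructor];
     rewrite ?mxE// => ? *; rewrite ?mxE//; move=> ?; rewrite !mxE.
by apply: (Ck_on_linear (L := L) oU); exact: coord_continuous.
Qed.

(** Vector-valued maps are handled coordinatewise, as sums of scalar functions
    times constant vectors. *)
Lemma Ck_on_row V (U : set V) k n (f : V -> 'rV[R]_n) : open U ->
  (forall i, Ck_on k U (fun x => f x 0 i)) -> Ck_on k U f.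
Proof.
move=> oU Cf.
rewrite (_ : f = fun x => \sum_i f x 0 i *: delta_mx 0 i).
  by apply: Ck_on_sum => // i; apply: Ck_onZl.
by apply/funext => x; exact: row_sum_delta.
Qed.

Lemma Ck_on_pair V (W W' : normedModType R) (U : set V) k (f : V -> W)
    (g : V -> W') : open U ->
  Ck_on k U f -> Ck_on k U g -> Ck_on k U (fun x => (f x, g x)).
Proof.
move=> oU; elim: k f g => [|k IH] f g /=.
  by move=> cf cg x Ux; apply: cvg_pair; [exact: cf|exact: cg].
move=> [df Df] [dg Dg]; split=> [x Ux|v].
  by apply: differentiable_pair; [exact: df|exact: dg].
apply: (Ck_on_ext oU) (IH _ _ (Df v) (Dg v)) => x Ux.
have dfx := df x Ux; have dgx := dg x Ux.
rewrite deriveE // deriveE // deriveE; last exact: differentiable_pair.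
by rewrite diff_pair.
Qed.

(** Composition with a function of one variable, which is all that is needed for
    inverses, square roots and trigonometric functions of smooth maps. *)
Lemma Ck_on_comp V (U : set V) (I : set R) k (h : R -> R) (f : V -> R) :
  open U -> (forall x, U x -> I (f x)) ->
  Ck_on k I h -> Ck_on k U f -> Ck_on k U (fun x => h (f x)).
Proof.
move=> oU UI; elim: k h f UI => [|k IH] h f UI.
  move=> ch cf x Ux; apply: continuous_comp; first exact: cf.
  by apply: ch; exact: UI.
move=> [dh Dh] Cf; have [df Df] := Cf; split=> [x Ux|v].
  apply: differentiable_comp; first exact: df.
  by apply: dh; exact: UI.
have C1 := IH _ _ UI (Dh 1) (Ck_onS Cf).
apply: (Ck_on_ext oU) (Ck_onM oU C1 (Df v)) => x Ux.
have dfx := df x Ux; have dhx := dh _ (UI x Ux).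
rewrite [in RHS]deriveE; last exact: differentiable_comp.
rewrite diff_comp //= [in LHS]deriveE // [in LHS]deriveE //.
rewrite -[X in _ = 'd _ _ X]mulr1 -[X in 'd _ _ X]/('d f x v *: 1).
by rewrite linearZ /= mulrC.
Qed.

End SmoothCalculus.

(** * Elementary functions and mixed derivatives *)

Section RealFunctions.
Context {R : realType}.
Implicit Types V W : normedModType R.

Lemma Ck_onN V (U : set V) k (f : V -> R) : open U ->
  Ck_on k U f -> Ck_on k U (fun x => - f x).
Proof.
move=> oU Cf; under eq_fun do rewrite -mulN1r.
by apply: Ck_onM => //; exact: Ck_on_cst.
Qed.

(** A function of one variable inherits smoothness from its derivative; all the
    elementary functions below follow from this by induction on the order. *)
Lemma Ck_onS_derive (U : set R) k (h dh : R -> R) : open U ->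
  (forall x, U x -> is_derive x 1 h (dh x)) -> Ck_on k U dh -> Ck_on k.+1 U h.
Proof.
move=> oU hdh Cdh.
have dfh x : U x -> differentiable h x.
  by move=> Ux; apply/derivable1_diffP; have [] := hdh x Ux.
split=> // v.
apply: (Ck_on_ext oU) (Ck_onM oU (Ck_on_cst U k v) Cdh) => x Ux.
have := @derive_val _ _ _ _ _ _ _ (hdh x Ux); rewrite deriveE; last exact: dfh.
move=> <-; rewrite deriveE; last exact: dfh.
by rewrite -[X in _ = 'd _ _ X]mulr1 -[X in _ = 'd _ _ X]/(v *: 1) linearZ.
Qed.

Lemma Ck_on_cos_sin k (U : set R) : open U -> Ck_on k U cos /\ Ck_on k U sin.
Proof.
move=> oU; elim: k => [|k [IHc IHs]].
  by split=> x _; [exact: continuous_cos|exact: continuous_sin].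
split; first by apply: (Ck_onS_derive oU) (Ck_onN oU IHs) => x _.
exact: (Ck_onS_derive oU) IHc.
Qed.

Lemma Ck_on_invr k : Ck_on k [set x : R | x != 0] (@GRing.inv R).
Proof.
elim: k => [|k IH]; first by move=> x /= x0; exact: inv_continuous.
pose dh (x : R) := - (x^-1 * x^-1).
apply: (Ck_onS_derive (dh := dh)); first exact: open_neq.
  move=> x x0; rewrite /dh.
  have -> : - (x^-1 * x^-1) = - x ^- 2 *: 1 :> R.
    by rewrite /GRing.scale /= mulr1 expr2 invfM.
  exact: (is_deriveV (f := id) x0 (is_derive_id x (1 : R))).
by apply: Ck_onN; [exact: open_neq|apply: Ck_onM => //; exact: open_neq].
Qed.

Lemma Ck_onV V (U : set V) k (f : V -> R) : open U ->
  (forall x, U x -> f x != 0) -> Ck_on k U f -> Ck_on k U (fun x => (f x)^-1).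
Proof. by move=> oU f0; apply: Ck_on_comp (Ck_on_invr k). Qed.

Lemma Ck_on_sqrtr k : Ck_on k [set x : R | 0 < x] (@Num.sqrt R).
Proof.
have oU : open [set x : R | 0 < x] by exact: open_gt.
elim: k => [|k IH]; first by move=> x _; exact: sqrt_continuous.
apply: (Ck_onS_derive oU (fun x x0 => is_derive1_sqrt x0)).
apply: (Ck_onV oU) => [x /= x0|]; first by rewrite mulf_neq0 // sqrtr_eq0 -ltNge.
by apply: Ck_onM => //; exact: Ck_on_cst.
Qed.

Lemma Ck_on_sqrt V (U : set V) k (f : V -> R) : open U ->
  (forall x, U x -> 0 < f x) -> Ck_on k U f ->
  Ck_on k U (fun x => Num.sqrt (f x)).
Proof. by move=> oU f0; apply: Ck_on_comp (Ck_on_sqrtr k). Qed.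

Lemma Ck_on_atan k : Ck_on k setT (@atan R).
Proof.
have oT : open [set: R] by exact: openT.
elim: k => [|k IH]; first by move=> x _; exact: continuous_atan.
apply: (Ck_onS_derive oT (fun x _ => is_derive1_atan x)).
apply: (Ck_onV oT) => [x _|]; first by rewrite gt_eqF // ltr_pwDl // sqr_ge0.
apply: Ck_onD => //; first exact: Ck_on_cst.
by under eq_fun do rewrite expr2; apply: Ck_onM => //; exact: Ck_on_id.
Qed.

Lemma Ck_on_scale V (U : set V) k n (a : V -> R) (f : V -> 'rV[R]_n) : open U ->
  Ck_on k U a -> Ck_on k U f -> Ck_on k U (fun x => a x *: f x).
Proof.
move=> oU Ca Cf; apply: Ck_on_row => // i; under eq_fun do rewrite mxE.
by apply: Ck_onM => //; exact: Ck_on_coord.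
Qed.

Lemma Ck_on_dotv V (U : set V) k (f g : V -> 'rV[R]_4) : open U ->
  Ck_on k U f -> Ck_on k U g -> Ck_on k U (fun x => dotv (f x) (g x)).
Proof.
by move=> oU Cf Cg; apply: Ck_on_sum => // i; apply: Ck_onM => //; exact: Ck_on_coord.
Qed.

Lemma derive_coord V n (f : V -> 'rV[R]_n) x v i : differentiable f x ->
  'D_v (fun y => f y 0 i) x = 'D_v f x 0 i.
Proof. by move=> df; rewrite derive_mx ?mxE //; exact: diff_derivable. Qed.

Lemma differentiable_coordf V n (f : V -> 'rV[R]_n) x i : differentiable f x ->
  differentiable (fun y => f y 0 i) x.
Proof.
move=> df.
exact: (@differentiable_comp _ _ _ _ f (fun N : 'rV[R]_n => N 0 i : R) x df
  (differentiable_coord _ _ _)).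
Qed.

Lemma derive_dotv V (f g : V -> 'rV[R]_4) x v :
  differentiable f x -> differentiable g x ->
  'D_v (fun y => dotv (f y) (g y)) x =
  dotv ('D_v f x) (g x) + dotv (f x) ('D_v g x).
Proof.
move=> df dg; rewrite /dotv.
have dfg (i : 'I_4) :
    derivable ((fun y => f y 0 i) * (fun y => g y 0 i)) x v.
  by apply: diff_derivable; apply: differentiableM; exact: differentiable_coordf.
have -> : (fun y => \sum_(i < 4) f y 0 i * g y 0 i)
        = \sum_(i < 4) ((fun y => f y 0 i) * (fun y => g y 0 i)).
  by apply/funext => y; rewrite fct_sumE.
rewrite derive_sum // -big_split /=; apply: eq_bigr => i _.
rewrite deriveM; try by apply: diff_derivable; exact: differentiable_coordf.
by rewrite !derive_coord // addrC; congr (_ + _); rewrite /GRing.scale /= mulrC.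
Qed.

(** Directional derivatives are derivatives along lines, which brings the mean
    value theorem to bear. *)
Lemma is_derive_line V W (F : V -> W) (x v : V) (t : R) :
  differentiable F (x + t *: v) ->
  is_derive t 1 (fun s => F (x + s *: v)) ('D_v F (x + t *: v)).
Proof.
move=> dF.
have il : is_diff t (fun s : R => x + s *: v) (fun s => s *: v).
  by apply: is_diff_eq; rewrite add0r.
have ic := is_diff_comp il (differentiableP dF).
apply: DeriveDef; first by apply: diff_derivable; exact: (@ex_diff _ _ _ _ _ _ _ ic).
rewrite deriveE; last exact: (@ex_diff _ _ _ _ _ _ _ ic).
by rewrite (@diff_val _ _ _ _ _ _ _ ic) /= scale1r deriveE.
Qed.

Lemma MVT0 (phi dphi : R -> R) (h : R) : 0 < h ->
  (forall t : R, is_derive t 1 phi (dphi t)) ->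
  exists2 c, 0 < c < h & phi h - phi 0 = dphi c * h.
Proof.
move=> h0 dp.
have [c ch ->] := MVT h0 (fun x _ => dp x)
  (derivable_within_continuous (fun x _ => @ex_derive _ _ _ _ _ _ _ (dp x))).
by exists c; [move: ch; rewrite in_itv|rewrite subr0].
Qed.

(** The mean value theorem in the direction [u], then in the direction [v]. *)
Lemma second_difference V (F : V -> R) (x u v : V) (h : R) : 0 < h ->
  (forall y, differentiable F y) -> (forall y, differentiable ('D_u F) y) ->
  exists s t, [/\ 0 < s < h, 0 < t < h &
    F (x + h *: u + h *: v) - F (x + h *: u) - F (x + h *: v) + F x
    = 'D_v ('D_u F) (x + s *: u + t *: v) * h * h].
Proof.
move=> h0 dF dDF.
pose phi s := F (x + h *: v + s *: u) - F (x + s *: u).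
have dphi (s : R) : is_derive s 1 phi
    ('D_u F (x + h *: v + s *: u) - 'D_u F (x + s *: u)).
  by apply: is_deriveB; exact: is_derive_line.
have [s sh Es] := MVT0 h0 dphi.
have dpsi t := is_derive_line (t := t) (dDF ((x + s *: u) + t *: v)).
have [t th Et] := MVT0 h0 dpsi.
exists s, t; split => //; rewrite -Et scale0r addr0 -[x + s *: u + _]addrAC -Es.
by rewrite /phi !scale0r !addr0 [x + h *: v + _]addrAC; ring.
Qed.

(** Symmetry of second derivatives: the second difference is symmetric in [u] and
    [v], and equals either mixed derivative at some nearby point, up to the same
    factor; continuity of both mixed derivatives concludes. *)
Lemma derive_comm V (F : V -> R) (u v : V) : smooth_on setT F ->
  'D_u ('D_v F) = 'D_v ('D_u F).
Proof.
move=> sF.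
have dF y : differentiable F y by have [+ _] := sF 1%N; exact.
have dDF w y : differentiable ('D_w F) y.
  by have [_ /(_ w) [+ _]] := sF 2%N; exact.
have cDF w w' y : {for y, continuous ('D_w' ('D_w F))}.
  by apply: differentiable_continuous; have [_ /(_ w) [_ /(_ w') [+ _]]] := sF 3%N; exact.
apply/funext => x; apply/eqP; rewrite -subr_eq0; apply/negP => /negP ne0.
set a : R := 'D_u ('D_v F) x in ne0 *; set b : R := 'D_v ('D_u F) x in ne0 *.
have e0 : 0 < `|a - b| / 2 by rewrite divr_gt0 // normr_gt0.
have /cvgr_dist_lt/(_ _ e0)/nbhs_normP[r1 /= r10 r1P] := cDF v u x.
have /cvgr_dist_lt/(_ _ e0)/nbhs_normP[r2 /= r20 r2P] := cDF u v x.
pose r := Num.min r1 r2.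
have r0 : 0 < r by rewrite lt_min r10.
pose n : R := `|u| + `|v| + 1.
pose h : R := r / n / 2.
have n0 : 0 < n by rewrite ltr_wpDl // addr_ge0.
have h0 : 0 < h by rewrite !divr_gt0.
have hr s t : 0 < s < h -> 0 < t < h -> `|x - (x + s *: u + t *: v)| < r.
  move=> /andP[s0 sh] /andP[t0 th].
  rewrite -addrA opprD addNKr normrN (le_lt_trans (ler_normD _ _)) //.
  rewrite !normrZ !gtr0_norm //.
  apply: (@le_lt_trans _ _ (h * n)).
    by rewrite !mulrDr -[leLHS]addr0 !lerD ?ler_wpM2r ?mulr1 // ltW.
  by rewrite /h mulrAC divfK ?gt_eqF // ltr_pdivrMr // ltr_pMr // ltr1n.
have [s [t [sh th E1]]] := second_difference x v h0 dF (dDF u).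
have [t' [s' [th' sh' E2]]] := second_difference x u h0 dF (dDF v).
have hz := hr _ _ sh th.
have hz' : `|x - (x + t' *: v + s' *: u)| < r.
  by rewrite (addrAC x (t' *: v)); exact: hr.
have hvu : x + h *: v + h *: u = x + h *: u + h *: v by exact: addrAC.
rewrite hvu in E2.
move: hz hz' E1 E2; move: (x + s *: u + t *: v) => z.
move: (x + t' *: v + s' *: u) => z' hz hz' E1 E2.
move: hz; rewrite lt_min => /andP[_ /r2P /=]; rewrite -/b => h2.
move: hz'; rewrite lt_min => /andP[/r1P /= + _]; rewrite -/a => h1.
move: h1 h2 E1 E2; move: ('D_u ('D_v F) z') ('D_v ('D_u F) z) => c d h1 h2 E1 E2.
have E : d = c.
  apply: (mulIf (lt0r_neq0 h0)); apply: (mulIf (lt0r_neq0 h0)).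
  by rewrite -E1 -E2; congr (_ + _); exact: addrAC.
rewrite E distrC in h2.
have := le_lt_trans (ler_normD (a - c) (c - b)) (ltrD h1 h2).
by rewrite subrKA -splitr ltxx.
Qed.

End RealFunctions.

(** * Euclidean geometry of the 4-dimensional space *)

Section Euclid4.
Context {R : realType}.
Implicit Types u v w : 'rV[R]_4.

Lemma dotvE u v : dotv u v =
  u 0 0 * v 0 0 + u 0 1 * v 0 1 + u 0 2 * v 0 2 + u 0 3 * v 0 3.
Proof.
rewrite /dotv !big_ord_recr big_ord0 /= add0r.
by congr (_ + _ + _ + _); congr (u 0 _ * v 0 _); apply/val_inj.
Qed.

Lemma dotvC u v : dotv u v = dotv v u.
Proof. by apply: eq_bigr => i _; rewrite mulrC. Qed.

Lemma dotvDl u v w : dotv (u + v) w = dotv u w + dotv v w.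
Proof. by rewrite -big_split; apply: eq_bigr => i _; rewrite mxE mulrDl. Qed.

Lemma dotvZl a u w : dotv (a *: u) w = a * dotv u w.
Proof. by rewrite mulr_sumr; apply: eq_bigr => i _; rewrite mxE mulrA. Qed.

Lemma dotvNl u w : dotv (- u) w = - dotv u w.
Proof. by rewrite -scaleN1r dotvZl mulN1r. Qed.

Lemma dotv0l w : dotv 0 w = 0.
Proof. by rewrite -(scale0r 0) dotvZl mul0r. Qed.

Lemma dotvDr u v w : dotv w (u + v) = dotv w u + dotv w v.
Proof. by rewrite dotvC dotvDl !(dotvC w). Qed.

Lemma dotvZr a u w : dotv w (a *: u) = a * dotv w u.
Proof. by rewrite dotvC dotvZl (dotvC w). Qed.

Lemma dotvNr u w : dotv w (- u) = - dotv w u.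
Proof. by rewrite dotvC dotvNl (dotvC w). Qed.

Lemma dotv0r w : dotv w 0 = 0.
Proof. by rewrite dotvC dotv0l. Qed.

Definition dotvLE := (dotvDl, dotvDr, dotvZl, dotvZr, dotvNl, dotvNr, dotv0l, dotv0r).

Lemma dotv_ge0 u : 0 <= dotv u u.
Proof. by apply: sumr_ge0 => i _; rewrite -expr2 sqr_ge0. Qed.

Lemma dotv_eq0 u : dotv u u = 0 -> u = 0.
Proof.
move=> u0; apply/rowP => i; rewrite mxE; apply/eqP; rewrite -sqrf_eq0 expr2.
apply: contra_eqT u0 => ui0; rewrite gt_eqF // /dotv (bigD1 i) //=.
rewrite ltr_pwDl //; first by rewrite lt0r ui0 -expr2 sqr_ge0.
by apply: sumr_ge0 => j _; rewrite -expr2 sqr_ge0.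
Qed.

Lemma dotv_gt0 u : u != 0 -> 0 < dotv u u.
Proof.
by move=> u0; rewrite lt0r dotv_ge0 andbT; apply: contra_neq u0 => /dotv_eq0.
Qed.

Lemma enorm_sqr u : enorm u ^+ 2 = dotv u u.
Proof. by rewrite sqr_sqrtr // dotv_ge0. Qed.

Lemma dotv_unit_le1 u v : dotv u u = 1 -> dotv v v = 1 -> -1 <= dotv u v <= 1.
Proof.
move=> u1 v1.
have := dotv_ge0 (u - v); rewrite !dotvLE u1 v1 (dotvC v u) => h1.
have := dotv_ge0 (u + v); rewrite !dotvLE u1 v1 (dotvC v u) => h2.
by apply/andP; split; lra.
Qed.

Lemma dotv_unit_eq u v : dotv u u = 1 -> dotv v v = 1 -> dotv u v = 1 -> u = v.
Proof.
move=> u1 v1 uv; apply/eqP; rewrite -subr_eq0; apply/eqP/dotv_eq0.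
by rewrite !dotvLE (dotvC v u) u1 v1 uv; ring.
Qed.

Lemma rcoordE u : [/\ rcoord u 0 = u 0 0, rcoord u 1 = u 0 1,
  rcoord u 2 = u 0 2 & rcoord u 3 = u 0 3].
Proof. by split; congr (u 0 _); apply/val_inj; rewrite /= inordK. Qed.

Lemma S3E u : S3 u <-> dotv u u = 1.
Proof.
rewrite /S3 /= /znorm1 /znorm2 !sqr_sqrtr ?addr_ge0 ?sqr_ge0 //.
by have [-> -> -> ->] := rcoordE u; rewrite dotvE !addrA -!expr2.
Qed.

Definition orthonormal4 (b : 'I_4 -> 'rV[R]_4) :=
  forall i j, dotv (b i) (b j) = (i == j)%:R.

(** A square matrix with orthonormal rows is inverted by its transpose on either
    side. *)
Lemma orthonormal4_sum (b : 'I_4 -> 'rV[R]_4) u : orthonormal4 b ->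
  u = \sum_i dotv u (b i) *: b i.
Proof.
move=> ob; pose F := \matrix_i b i.
have FF : F *m F^T = 1%:M.
  apply/matrixP => i j; rewrite !mxE -(ob i j).
  by apply: eq_bigr => k _; rewrite !mxE.
rewrite -{1}[u]mulmx1 -(mulmx1C FF) mulmxA mulmx_sum_row; apply: eq_bigr => i _.
rewrite rowK; congr (_ *: _); rewrite mxE.
by apply: eq_bigr => k _; rewrite !mxE.
Qed.

Definition vec4 (x0 x1 x2 x3 : R) : 'rV[R]_4 :=
  \row_(i < 4) [:: x0; x1; x2; x3]`_i.

Lemma dotv_vec4 u (x0 x1 x2 x3 : R) : dotv u (vec4 x0 x1 x2 x3) =
  u 0 0 * x0 + u 0 1 * x1 + u 0 2 * x2 + u 0 3 * x3.
Proof. by rewrite dotvE !mxE. Qed.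

(** The generalized cross product: the cofactors of the 4 x 4 determinant with
    rows [a], [b], [c] along its fourth row. *)
Definition cross (a b c : 'rV[R]_4) : 'rV[R]_4 :=
  let m (i j k : 'I_4) := a 0 i * (b 0 j * c 0 k - b 0 k * c 0 j)
    - a 0 j * (b 0 i * c 0 k - b 0 k * c 0 i)
    + a 0 k * (b 0 i * c 0 j - b 0 j * c 0 i) in
  vec4 (- m 1 2 3) (m 0 2 3) (- m 0 1 3) (m 0 1 2).

Lemma dotv_cross (a b c : 'rV[R]_4) :
  [/\ dotv a (cross a b c) = 0, dotv b (cross a b c) = 0 &
      dotv c (cross a b c) = 0].
Proof. by split; rewrite dotv_vec4; ring. Qed.

(** The squared norm of the cross product is the Gram determinant of the factors. *)
Lemma cross_norm (a b c : 'rV[R]_4) :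
  dotv a a = 1 -> dotv b b = 1 -> dotv c c = 1 ->
  dotv a b = 0 -> dotv a c = 0 -> dotv b c = 0 ->
  dotv (cross a b c) (cross a b c) = 1.
Proof.
move=> a1 b1 c1 ab ac bc.
transitivity (dotv a a * (dotv b b * dotv c c - dotv b c ^+ 2)
  - dotv a b * (dotv a b * dotv c c - dotv b c * dotv a c)
  + dotv a c * (dotv a b * dotv b c - dotv b b * dotv a c)).
  rewrite dotv_vec4 !dotvE !mxE /=; ring.
by rewrite a1 b1 c1 ab ac bc; ring.
Qed.

Definition family4 (b0 b1 b2 b3 : 'rV[R]_4) (i : 'I_4) : 'rV[R]_4 :=
  nth 0 [:: b0; b1; b2; b3] i.

Lemma sum_family4 (W : nmodType) (b0 b1 b2 b3 : 'rV[R]_4) (F : 'rV[R]_4 -> W) :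
  \sum_i F (family4 b0 b1 b2 b3 i) = F b0 + F b1 + F b2 + F b3.
Proof. by rewrite !big_ord_recr big_ord0 /= add0r. Qed.

Lemma orthonormal4_cross (a b c : 'rV[R]_4) :
  dotv a a = 1 -> dotv b b = 1 -> dotv c c = 1 ->
  dotv a b = 0 -> dotv a c = 0 -> dotv b c = 0 ->
  orthonormal4 (family4 a b c (cross a b c)).
Proof.
move=> a1 b1 c1 ab ac bc; have [ax bx cx] := dotv_cross a b c.
have xx := cross_norm a1 b1 c1 ab ac bc.
move: (cross a b c) ax bx cx xx => x ax bx cx xx.
by move=> [[|[|[|[|//]]]] i4] [[|[|[|[|//]]]] j4]; rewrite /family4 /= // dotvC.
Qed.

End Euclid4.

(** * Periodic divergences of constant sign *)

Section PeriodicDivergence.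
Context {R : realType}.
Notation mu := (@lebesgue_measure R).

(** The function is nondecreasing with no net increase, hence constant. *)
Lemma flat_derive (F : R -> R) (a b c : R) : a < c < b ->
  (forall x, x \in `]a, b[ -> derivable F x 1) ->
  (forall x, x \in `]a, b[ -> 0 <= F^`()%classic x) ->
  {within `[a, b], continuous F} -> F b <= F a -> F^`()%classic c = 0.
Proof.
move=> /andP[ac cb] dF F0 cF Fba.
have mono := ger0_derive1_le_cc dF F0 cF.
have Fcst x : x \in `]a, b[ -> F x = F a.
  rewrite in_itv /= => /andP[ax xb]; have ab := lt_trans ax xb.
  apply/eqP; rewrite eq_le; apply/andP; split.
    by apply: le_trans Fba; apply: mono; rewrite ?in_itv /= ?lexx ?(ltW ax) ?(ltW xb) ?(ltW ab).
  by apply: mono; rewrite ?in_itv /= ?lexx ?(ltW ax) ?(ltW xb) ?(ltW ab).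
rewrite derive1E (@near_eq_derive _ _ _ _ (cst (F a))); first exact: derive_cst.
have : c \in `]a, b[ by rewrite in_itv /= ac cb.
by move=> /near_in_itvoo; apply: filterS => x; exact: Fcst.
Qed.

Lemma integrable_unit (f : R -> R) : continuous f ->
  mu.-integrable `[0, 1] (EFin \o f).
Proof.
move=> cf; apply: continuous_compact_integrable; first exact: segment_compact.
exact: continuous_subspaceT.
Qed.

Lemma continuous_integral_eq0 (f : R -> R) (c : R) : 0 < c < 1 ->
  continuous f -> (forall x, 0 <= f x) -> \int[mu]_(x in `[0, 1]) f x = 0 ->
  f c = 0.
Proof.
move=> c01 cf f0 int0.
pose G x := \int[mu]_(t in `[0, x]) f t.
have G' x : x \in `]0, 1[ -> derivable G x 1 /\ G^`()%classic x = f x.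
  rewrite in_itv /= => /andP[x0 x1].
  by apply: (continuous_FTC1_closed x1) => //; [exact: integrable_unit|exact: cf].
have [_ <-] : derivable G c 1 /\ G^`()%classic c = f c by apply: G'; rewrite in_itv.
apply: (@flat_derive _ 0 1) => //.
- by move=> x /G'[].
- by move=> x /G'[_ ->].
- exact: (parameterized_integral_continuous ler01 (integrable_unit cf)).
- by rewrite /G set_itv1 Rintegral_set1 int0.
Qed.

Lemma integral_derive_periodic (g dg : R -> R) : continuous dg ->
  (forall t : R, is_derive t 1 g (dg t)) -> g 1 = g 0 ->
  \int[mu]_(t in `[0, 1]) dg t = 0.
Proof.
move=> cdg hg g10.
have cg : continuous g.
  by move=> t; apply/differentiable_continuous/derivable1_diffP; have [] := hg t.
rewrite /Rintegral (continuous_FTC2 ltr01 (F := g)) ?g10 ?subee //.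
- exact: continuous_subspaceT.
- split; first by move=> t _; have [] := hg t.
  + exact/cvg_at_right_filter/cg.
  + exact/cvg_at_left_filter/cg.
- by move=> t _; rewrite derive1E; have [_] := hg t.
Qed.

(** Differentiation under the integral sign; the derivative is dominated by its
    maximum over a compact rectangle. *)
Lemma derive_integral_unit (f df : R -> R -> R) (a : R) :
  (forall s t : R, is_derive s 1 (f^~ t) (df s t)) -> (forall s, continuous (f s)) ->
  continuous (fun p : R * R => df p.1 p.2) ->
  derivable (fun s : R => \int[mu]_(t in `[0, 1]) f s t) a 1 /\
  (fun s : R => \int[mu]_(t in `[0, 1]) f s t)^`()%classic a
    = \int[mu]_(t in `[0, 1]) df a t.
Proof.
move=> hdf cf cdf.
have cdf2 : continuous (fun p : R * R => `|df p.1 p.2|).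
  by move=> p; apply: cvg_norm; exact: cdf.
pose K := `[a - 1, a + 1]%classic `*` `[0, 1 : R]%classic.
have K0 : K !=set0.
  exists (a, 0); split; rewrite /= in_itv /= ?lexx ?ler01 //.
  by rewrite gerBl lerDl ler01.
have cK : compact K by apply: compact_setX; exact: segment_compact.
have [m _ mP] := compact_EVT_max K0 cK (continuous_subspaceT cdf2).
have Ia : `]a - 1, a + 1[%classic a by rewrite /= in_itv /= gtrBl ltrDl ltr01.
have iP s : `]a - 1, a + 1[%classic s -> mu.-integrable `[0, 1] (EFin \o f s).
  by move=> _; exact: integrable_unit.
have deP s t : `]a - 1, a + 1[%classic s -> `[0, 1 : R]%classic t ->
    derivable (f^~ t) s 1 by move=> _ _; have [] := hdf s t.
pose C := `|df m.1 m.2|.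
have C0 (t : R) : 0 <= cst C t by exact: normr_ge0.
have iC : mu.-integrable `[0, 1] (EFin \o cst C).
  by apply: integrable_unit; exact: cst_continuous.
have ubP s t : `]a - 1, a + 1[%classic s -> `[0, 1 : R]%classic t ->
    `|partial1of2 f s t| <= C.
  move=> sa t01; rewrite partial1of2E; have [_ ->] := hdf s t.
  by apply: (mP (s, t)); rewrite inE; split => //=; exact: subset_itv_oo_cc.
split; first by apply: (derivable_under_integral _ Ia iP deP C0 iC ubP).
rewrite (differentiation_under_integral _ Ia iP deP C0 iC ubP) //.
by apply: eq_Rintegral => t _; rewrite partial1of2E; have [_ ->] := hdf a t.
Qed.

(** On a torus the integral of a divergence vanishes, so a divergence of constant
    sign vanishes identically.  Integrating over [v] kills the second component;
    the integral of [P] over [v], as a function of the position along [u], is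
    then nondecreasing and periodic, hence constant. *)
Lemma periodic_divergence_eq0 (V : normedModType R) (u v : V) (P Q : V -> R) :
  smooth_on setT P -> smooth_on setT Q ->
  (forall x, P (x + u) = P x) -> (forall x, Q (x + v) = Q x) ->
  (forall x, 0 <= 'D_u P x + 'D_v Q x) ->
  forall x, 'D_u P x + 'D_v Q x = 0.
Proof.
move=> sP sQ pP pQ ge0 x0.
have dP x : differentiable P x by have [+ _] := sP 1%N; exact.
have dQ x : differentiable Q x by have [+ _] := sQ 1%N; exact.
have cP : continuous P by move=> x; exact: differentiable_continuous.
have cDP : continuous ('D_u P).
  by move=> x; apply: differentiable_continuous; have [_ /(_ u) [+ _]] := sP 2%N; exact.
have cDQ : continuous ('D_v Q).
  by move=> x; apply: differentiable_continuous; have [_ /(_ v) [+ _]] := sQ 2%N; exact.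
(* The base point puts [x0] at the centre (1/2, 1/2) of the unit square. *)
pose z := x0 - 2^-1 *: u - 2^-1 *: v.
pose pt (s t : R) := z + s *: u + t *: v.
have cpt s : continuous (pt s).
  rewrite /pt => t.
  by apply: cvgD; [exact: cvg_cst|exact: scalel_continuous].
have cpf (g : V -> R) s : continuous g -> continuous (fun t => g (pt s t)).
  by move=> cg t; exact: (@continuous_comp _ _ _ (pt s) g t (cpt s t) (cg _)).
pose F s := \int[mu]_(t in `[0, 1]) P (pt s t).
have ptC s t : pt s t = z + t *: v + s *: u by rewrite /pt addrAC.
have dpt (s t : R) : is_derive s 1 (fun s => P (pt s t)) ('D_u P (pt s t)).
  under eq_fun do rewrite ptC.
  by rewrite ptC; exact: is_derive_line.
pose I s := \int[mu]_(t in `[0, 1]) ('D_u P (pt s t) + 'D_v Q (pt s t)).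
have cI s : continuous (fun t => 'D_u P (pt s t) + 'D_v Q (pt s t)).
  by move=> t; apply: cvgD; [exact: (cpf _ s cDP t)|exact: (cpf _ s cDQ t)].
have intDP s : \int[mu]_(t in `[0, 1]) 'D_u P (pt s t) = I s.
  have intDQ : \int[mu]_(t in `[0, 1]) 'D_v Q (pt s t) = 0.
    apply: (@integral_derive_periodic (fun t => Q (pt s t))).
    - exact: (cpf _ s cDQ).
    - by move=> t; exact: is_derive_line.
    - by rewrite /pt scale1r scale0r addr0 pQ.
  rewrite /I RintegralD ?intDQ ?addr0 //; apply: integrable_unit.
    exact: (cpf _ s cDP).
  exact: (cpf _ s cDQ).
have F' a : derivable F a 1 /\ F^`()%classic a = I a.
  have cpt2 : continuous (fun p : R * R => pt p.1 p.2).
    move=> p; apply: cvgD; last by apply: cvgZ; [exact: cvg_snd|exact: cvg_cst].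
    apply: cvgD; first exact: cvg_cst.
    by apply: cvgZ; [exact: cvg_fst|exact: cvg_cst].
  rewrite -intDP; apply: (derive_integral_unit a dpt (fun s => cpf _ s cP)) => p.
  exact: (@continuous_comp _ _ _ (fun p : R * R => pt p.1 p.2) ('D_u P) p
    (cpt2 p) (cDP _)).
have h2 : 0 < (2^-1 : R) < 1 by rewrite invr_gt0 ltr0n invf_lt1 // ltr1n.
have I0 : I 2^-1 = 0.
  have [_ <-] := F' 2^-1.
  apply: (@flat_derive _ 0 1) => //.
  - by move=> a _; have [] := F' a.
  - move=> a _; have [_ ->] := F' a.
    by apply: Rintegral_ge0 => t _; exact: ge0.
  - apply: continuous_subspaceT => s; apply/differentiable_continuous/derivable1_diffP.
    by have [] := F' s.
  - by rewrite /F; under eq_Rintegral do rewrite ptC scale1r pP -[_ + _ *: v]addr0 -(scale0r u) -ptC.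
have := continuous_integral_eq0 h2 (cI 2^-1) (fun t => ge0 _) I0.
by rewrite /pt /z addrAC !subrK.
Qed.

End PeriodicDivergence.

(** * Smooth vector fields *)

Section SmoothFunctions.
Context {R : realType} {V : normedModType R}.
Implicit Types W : normedModType R.

Lemma smooth_differentiable W (f : V -> W) x : smooth_on setT f -> differentiable f x.
Proof. by move=> sf; have [+ _] := sf 1%N; exact. Qed.

Lemma smooth_derive W (f : V -> W) w : smooth_on setT f -> smooth_on setT ('D_w f).
Proof. by move=> sf k; have [_ Df] := sf k.+1; exact: Df. Qed.

Lemma smooth_scale (a : V -> R) (f : V -> 'rV[R]_4) :
  smooth_on setT a -> smooth_on setT f -> smooth_on setT (fun x => a x *: f x).
Proof. by move=> sa sf k; apply: (Ck_on_scale openT). Qed.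

Lemma smooth_dotv (f g : V -> 'rV[R]_4) :
  smooth_on setT f -> smooth_on setT g -> smooth_on setT (fun x => dotv (f x) (g x)).
Proof. by move=> sf sg k; apply: (Ck_on_dotv openT). Qed.

Lemma smoothD W (f g : V -> W) :
  smooth_on setT f -> smooth_on setT g -> smooth_on setT (fun x => f x + g x).
Proof. by move=> sf sg k; apply: (Ck_onD openT). Qed.

Lemma smoothM (f g : V -> R) :
  smooth_on setT f -> smooth_on setT g -> smooth_on setT (fun x => f x * g x).
Proof. by move=> sf sg k; apply: (Ck_onM openT). Qed.

Lemma smoothN (f : V -> R) : smooth_on setT f -> smooth_on setT (fun x => - f x).
Proof. by move=> sf k; apply: (Ck_onN openT). Qed.

Lemma smoothV (f : V -> R) : (forall x, f x != 0) ->
  smooth_on setT f -> smooth_on setT (fun x => (f x)^-1).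
Proof. by move=> f0 sf k; apply: (Ck_onV openT). Qed.

Lemma smooth_enorm (f : V -> 'rV[R]_4) : (forall x, 0 < dotv (f x) (f x)) ->
  smooth_on setT f -> smooth_on setT (fun x => enorm (f x)).
Proof. by move=> f0 sf k; apply: (Ck_on_sqrt openT) => //; exact: (Ck_on_dotv openT). Qed.

Lemma smooth_cross (f g h : V -> 'rV[R]_4) :
  smooth_on setT f -> smooth_on setT g -> smooth_on setT h ->
  smooth_on setT (fun x => cross (f x) (g x) (h x)).
Proof.
move=> sf sg sh k.
have C3 (i j l : 'I_4) : Ck_on k setT (fun x =>
    f x 0 i * (g x 0 j * h x 0 l - g x 0 l * h x 0 j)
    - f x 0 j * (g x 0 i * h x 0 l - g x 0 l * h x 0 i)
    + f x 0 l * (g x 0 i * h x 0 j - g x 0 j * h x 0 i)).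
  by do ?[apply: (Ck_onD openT)|apply: (Ck_onN openT)|apply: (Ck_onM openT)];
     apply: (Ck_on_coord _ openT).
apply: (Ck_on_row openT) => -[[|[|[|[|//]]]] i4].
- by under eq_fun do rewrite mxE /=; apply: (Ck_onN openT).
- by under eq_fun do rewrite mxE /=.
- by under eq_fun do rewrite mxE /=; apply: (Ck_onN openT).
- by under eq_fun do rewrite mxE /=.
Qed.

Lemma derive_scale (a : V -> R) (f : V -> 'rV[R]_4) x w :
  differentiable a x -> differentiable f x ->
  'D_w (fun y => a y *: f y) x = 'D_w a x *: f x + a x *: 'D_w f x.
Proof.
move=> da df; apply/rowP => i.
have daf : differentiable (fun y => a y *: f y) x.
  have -> : (fun y => a y *: f y)
          = \sum_(i < 4) (fun y => (a y * f y 0 i) *: (delta_mx 0 i : 'rV[R]_4)).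
    apply/funext => y; rewrite fct_sumE {1}(row_sum_delta (f y)) scaler_sumr.
    by apply: eq_bigr => j _; rewrite scalerA.
  apply: differentiable_sum => j; apply: differentiableZl.
  by apply: differentiableM => //; exact: differentiable_coordf.
rewrite -derive_coord //; under eq_fun do rewrite mxE.
rewrite -[LHS]/('D_w (a * (fun y => f y 0 i)) x) deriveM; last 2 first.
- exact: diff_derivable.
- by apply: diff_derivable; exact: differentiable_coordf.
by rewrite derive_coord // !mxE addrC /GRing.scale /= (mulrC (f x 0 i)).
Qed.

Lemma derive_periodic W (f : V -> W) p w :
  (forall x, f (x + p) = f x) -> forall x, 'D_w f (x + p) = 'D_w f x.
Proof.
by move=> fp x; rewrite /derive; under eq_fun do rewrite /= addrA !fp.
Qed.

Lemma derive_comm_row n (f : V -> 'rV[R]_n) u v x : smooth_on setT f ->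
  'D_u ('D_v f) x = 'D_v ('D_u f) x.
Proof.
move=> sf; apply/rowP => i.
have dD w y : differentiable ('D_w f) y.
  exact: (smooth_differentiable y (smooth_derive w sf)).
have Di w : (fun y => 'D_w f y 0 i) = 'D_w (fun y => f y 0 i).
  apply/funext => y; rewrite derive_coord //; exact: smooth_differentiable.
have DDi w w' : 'D_w ('D_w' f) x 0 i = 'D_w ('D_w' (fun y => f y 0 i)) x.
  by rewrite -Di; exact/esym/derive_coord.
have C : 'D_u ('D_v (fun y => f y 0 i)) = 'D_v ('D_u (fun y => f y 0 i)).
  by apply: derive_comm => k; exact: (Ck_on_coord i openT (sf k)).
exact: etrans (DDi u v) (etrans (congr1 (fun g => g x) C) (esym (DDi v u))).
Qed.

(** Derivatives of the orthogonality relations of a moving frame. *)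
Lemma dotv_derive_cst (f g : V -> 'rV[R]_4) (c : R) :
  smooth_on setT f -> smooth_on setT g -> (forall x, dotv (f x) (g x) = c) ->
  forall x w, dotv ('D_w f x) (g x) = - dotv (f x) ('D_w g x).
Proof.
move=> sf sg fgc x w; apply/eqP; rewrite -addr_eq0 -derive_dotv;
  try exact: smooth_differentiable.
have -> : (fun y => dotv (f y) (g y)) = (fun=> c) by exact/funext.
by rewrite derive_cst.
Qed.

Lemma dotv_derive_unit (f : V -> 'rV[R]_4) :
  smooth_on setT f -> (forall x, dotv (f x) (f x) = 1) ->
  forall x w, dotv ('D_w f x) (f x) = 0.
Proof.
move=> sf f1 x w; have := dotv_derive_cst sf sf f1 x w.
rewrite (dotvC (f x)) => /eqP.
by rewrite -addr_eq0 -mulr2n mulrn_eq0 => /eqP.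
Qed.

Lemma derive_linear W (f : V -> W) x u v (a b : R) : differentiable f x ->
  'D_(a *: u + b *: v) f x = a *: 'D_u f x + b *: 'D_v f x.
Proof. by move=> df; rewrite !deriveE // linearD !linearZ. Qed.

End SmoothFunctions.

(** * Framed surfaces in the sphere and the Gauss-Bonnet theorem *)

(** A surface in the sphere, parametrized by [fr_f], with a smooth
    orthonormal frame of the ambient space: position, two tangent vectors
    obtained from the coordinate vectors by the Gram-Schmidt process (whence the
    triangular matrix of coefficients), and the unit normal. *)
Record framed_surface {R : realType} {V : normedModType R} (u v : V) := FramedSurface {
  fr_f : V -> 'rV[R]_4;
  fr_e1 : V -> 'rV[R]_4;
  fr_e2 : V -> 'rV[R]_4;
  fr_nu : V -> 'rV[R]_4;
  fr_a11 : V -> R;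
  fr_a21 : V -> R;
  fr_a22 : V -> R;
  fr_sf : smooth_on setT fr_f;
  fr_se1 : smooth_on setT fr_e1;
  fr_se2 : smooth_on setT fr_e2;
  fr_snu : smooth_on setT fr_nu;
  fr_orthonormal : forall x,
    orthonormal4 (family4 (fr_f x) (fr_e1 x) (fr_e2 x) (fr_nu x));
  fr_Duf : forall x, 'D_u fr_f x = fr_a11 x *: fr_e1 x;
  fr_Dvf : forall x, 'D_v fr_f x = fr_a21 x *: fr_e1 x + fr_a22 x *: fr_e2 x;
  fr_a11_gt0 : forall x, 0 < fr_a11 x;
  fr_a22_gt0 : forall x, 0 < fr_a22 x;
  fr_periodic : forall p, (forall x, fr_f (x + p) = fr_f x) -> forall x,
    fr_e1 (x + p) = fr_e1 x /\ fr_e2 (x + p) = fr_e2 x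
}.

Section GramSchmidt.
Context {R : realType} {V : normedModType R} (u v : V) (f : V -> 'rV[R]_4).
Context (sf : smooth_on setT f) (f1 : forall x, dotv (f x) (f x) = 1).
Context (imm : forall x a b, a *: 'D_u f x + b *: 'D_v f x = 0 -> a = 0 /\ b = 0).

Definition gs_a11 x := enorm ('D_u f x).
Definition gs_e1 x := (gs_a11 x)^-1 *: 'D_u f x.
Definition gs_a21 x := dotv ('D_v f x) (gs_e1 x).
Definition gs_tangent2 x := 'D_v f x + (- gs_a21 x) *: gs_e1 x.
Definition gs_a22 x := enorm (gs_tangent2 x).
Definition gs_e2 x := (gs_a22 x)^-1 *: gs_tangent2 x.
Definition gs_nu x := cross (f x) (gs_e1 x) (gs_e2 x).

Lemma dotv_f_Df x w : dotv (f x) ('D_w f x) = 0.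
Proof.
by have := dotv_derive_cst sf sf f1 x w; rewrite dotvC => /eqP; rewrite -addr_eq0 -mulr2n mulrn_eq0 /= => /eqP.
Qed.

Lemma gs_Duf_gt0 x : 0 < dotv ('D_u f x) ('D_u f x).
Proof.
apply: dotv_gt0; apply/eqP => fu0.
have [|/eqP] := imm (x := x) (a := 1) (b := 0); last by rewrite oner_eq0.
by rewrite fu0 scaler0 scale0r addr0.
Qed.

Lemma gs_a11_gt0 x : 0 < gs_a11 x.
Proof. by rewrite sqrtr_gt0 gs_Duf_gt0. Qed.

Lemma gs_Duf x : 'D_u f x = gs_a11 x *: gs_e1 x.
Proof. by rewrite /gs_e1 scalerA divff ?scale1r // gt_eqF ?gs_a11_gt0. Qed.

Lemma gs_e1_unit x : dotv (gs_e1 x) (gs_e1 x) = 1.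
Proof.
rewrite /gs_e1 dotvZl dotvZr -enorm_sqr -/(gs_a11 x) expr2.
by field; rewrite gt_eqF ?gs_a11_gt0.
Qed.

Lemma gs_f_e1 x : dotv (f x) (gs_e1 x) = 0.
Proof. by rewrite dotvZr dotv_f_Df mulr0. Qed.

Lemma gs_e1_tangent2 x : dotv (gs_e1 x) (gs_tangent2 x) = 0.
Proof. by rewrite dotvDr dotvZr gs_e1_unit mulr1 (dotvC (gs_e1 x)) subrr. Qed.

Lemma gs_tangent2_gt0 x : 0 < dotv (gs_tangent2 x) (gs_tangent2 x).
Proof.
apply: dotv_gt0; apply/eqP => t0.
have [|_ /eqP] := imm (x := x) (a := - gs_a21 x / gs_a11 x) (b := 1); last by rewrite oner_eq0.
by rewrite scale1r addrC -[RHS]t0 /gs_tangent2 /gs_e1 scalerA.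
Qed.

Lemma gs_a22_gt0 x : 0 < gs_a22 x.
Proof. by rewrite sqrtr_gt0 gs_tangent2_gt0. Qed.

Lemma gs_tangent2E x : gs_tangent2 x = gs_a22 x *: gs_e2 x.
Proof. by rewrite /gs_e2 scalerA divff ?scale1r // gt_eqF ?gs_a22_gt0. Qed.

Lemma gs_Dvf x : 'D_v f x = gs_a21 x *: gs_e1 x + gs_a22 x *: gs_e2 x.
Proof. by rewrite -gs_tangent2E /gs_tangent2 scaleNr addrC subrK. Qed.

Lemma gs_e2_unit x : dotv (gs_e2 x) (gs_e2 x) = 1.
Proof.
rewrite /gs_e2 dotvZl dotvZr -enorm_sqr -/(gs_a22 x) expr2.
by field; rewrite gt_eqF ?gs_a22_gt0.
Qed.

Lemma gs_e1_e2 x : dotv (gs_e1 x) (gs_e2 x) = 0.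
Proof. by rewrite dotvZr gs_e1_tangent2 mulr0. Qed.

Lemma gs_f_e2 x : dotv (f x) (gs_e2 x) = 0.
Proof. by rewrite dotvZr dotvDr dotv_f_Df dotvZr gs_f_e1 mulr0 addr0 mulr0. Qed.

Lemma gs_orthonormal x : orthonormal4 (family4 (f x) (gs_e1 x) (gs_e2 x) (gs_nu x)).
Proof.
by apply: orthonormal4_cross;
   rewrite ?f1 ?gs_e1_unit ?gs_e2_unit ?gs_f_e1 ?gs_f_e2 ?gs_e1_e2.
Qed.

Lemma gs_periodic p : (forall x, f (x + p) = f x) -> forall x,
  gs_e1 (x + p) = gs_e1 x /\ gs_e2 (x + p) = gs_e2 x.
Proof.
move=> fp x; have Dp w : 'D_w f (x + p) = 'D_w f x by exact: derive_periodic.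
have e1p : gs_e1 (x + p) = gs_e1 x by rewrite /gs_e1 /gs_a11 Dp.
by split; [exact: e1p|rewrite /gs_e2 /gs_a22 /gs_tangent2 /gs_a21 e1p Dp].
Qed.

Lemma smooth_gs_e1 : smooth_on setT gs_e1.
Proof.
apply: smooth_scale; last exact: smooth_derive.
apply: smoothV; first by move=> x; rewrite gt_eqF ?gs_a11_gt0.
by apply: smooth_enorm; [exact: gs_Duf_gt0|exact: smooth_derive].
Qed.

Lemma smooth_gs_tangent2 : smooth_on setT gs_tangent2.
Proof.
apply: smoothD; first exact: smooth_derive.
apply: smooth_scale smooth_gs_e1; apply: smoothN.
by apply: smooth_dotv smooth_gs_e1; exact: smooth_derive.
Qed.

Lemma smooth_gs_a22V : smooth_on setT (fun x => (gs_a22 x)^-1).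
Proof.
apply: smoothV; first by move=> x; rewrite gt_eqF ?gs_a22_gt0.
by apply: smooth_enorm; [exact: gs_tangent2_gt0|exact: smooth_gs_tangent2].
Qed.

Lemma smooth_gs_e2 : smooth_on setT gs_e2.
Proof. exact: smooth_scale smooth_gs_a22V smooth_gs_tangent2. Qed.

Lemma smooth_gs_nu : smooth_on setT gs_nu.
Proof. exact: smooth_cross sf smooth_gs_e1 smooth_gs_e2. Qed.

Definition frame_of_immersion : framed_surface u v :=
  FramedSurface sf smooth_gs_e1 smooth_gs_e2 smooth_gs_nu gs_orthonormal
    gs_Duf gs_Dvf gs_a11_gt0 gs_a22_gt0 gs_periodic.

End GramSchmidt.

Section MovingFrame.
Context {R : realType} {V : normedModType R} {u v : V} (S : framed_surface u v).
Local Notation f := (fr_f S).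
Local Notation e1 := (fr_e1 S).
Local Notation e2 := (fr_e2 S).
Local Notation nu := (fr_nu S).
Local Notation a11 := (fr_a11 S).
Local Notation a21 := (fr_a21 S).
Local Notation a22 := (fr_a22 S).
Local Notation sf := (fr_sf S).
Local Notation smooth_e1 := (fr_se1 S).
Local Notation smooth_e2 := (fr_se2 S).
Local Notation smooth_nu := (fr_snu S).

Lemma frame_units x : [/\ dotv (f x) (f x) = 1, dotv (e1 x) (e1 x) = 1,
  dotv (e2 x) (e2 x) = 1 & dotv (nu x) (nu x) = 1].
Proof.
have ob := fr_orthonormal S x.
by split; [have := ob 0 0|have := ob 1 1|have := ob 2 2|have := ob 3 3].
Qed.

Lemma frame_orth x : [/\ dotv (f x) (e1 x) = 0, dotv (f x) (e2 x) = 0 &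
  dotv (f x) (nu x) = 0] /\ [/\ dotv (e1 x) (e2 x) = 0,
  dotv (e1 x) (nu x) = 0 & dotv (e2 x) (nu x) = 0].
Proof.
have ob := fr_orthonormal S x.
by split; split; [have := ob 0 1|have := ob 0 2|have := ob 0 3
  |have := ob 1 2|have := ob 1 3|have := ob 2 3].
Qed.

Lemma fr_e1_unit x : dotv (e1 x) (e1 x) = 1. Proof. by have [] := frame_units x. Qed.
Lemma fr_e2_unit x : dotv (e2 x) (e2 x) = 1. Proof. by have [] := frame_units x. Qed.
Lemma nu_unit x : dotv (nu x) (nu x) = 1. Proof. by have [] := frame_units x. Qed.

Lemma frame_dot x :
  (((dotv (f x) (f x) = 1) * (dotv (e1 x) (e1 x) = 1) *
    (dotv (e2 x) (e2 x) = 1) * (dotv (nu x) (nu x) = 1)) *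
   ((dotv (f x) (e1 x) = 0) * (dotv (e1 x) (f x) = 0) *
    (dotv (f x) (e2 x) = 0) * (dotv (e2 x) (f x) = 0) *
    (dotv (f x) (nu x) = 0) * (dotv (nu x) (f x) = 0)) *
   ((dotv (e1 x) (e2 x) = 0) * (dotv (e2 x) (e1 x) = 0) *
    (dotv (e1 x) (nu x) = 0) * (dotv (nu x) (e1 x) = 0) *
    (dotv (e2 x) (nu x) = 0) * (dotv (nu x) (e2 x) = 0)))%type.
Proof.
have [u1 u2 u3 u4] := frame_units x.
have [[h1 h2 h3] [h4 h5 h6]] := frame_orth x.
by do 20?[apply: pair]; rewrite // dotvC.
Qed.

Lemma frame_expand x y : y = dotv y (f x) *: f x + dotv y (e1 x) *: e1 x
  + dotv y (e2 x) *: e2 x + dotv y (nu x) *: nu x.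
Proof.
have ob := fr_orthonormal S x.
by rewrite {1}(orthonormal4_sum y ob); exact: (sum_family4 _ _ _ _ (fun b => dotv y b *: b)).
Qed.

Lemma frame_parseval x y z : dotv y z =
  dotv y (f x) * dotv z (f x) + dotv y (e1 x) * dotv z (e1 x)
  + dotv y (e2 x) * dotv z (e2 x) + dotv y (nu x) * dotv z (nu x).
Proof. by rewrite {1}(frame_expand x y) !dotvDl !dotvZl !(dotvC _ z). Qed.

Definition dnu11 x := dotv ('D_u nu x) (e1 x).
Definition dnu12 x := dotv ('D_u nu x) (e2 x).
Definition dnu21 x := dotv ('D_v nu x) (e1 x).
Definition dnu22 x := dotv ('D_v nu x) (e2 x).

Lemma nu_Duf x : dotv (nu x) ('D_u f x) = 0.
Proof. by rewrite (fr_Duf S) dotvZr frame_dot mulr0. Qed.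

Lemma nu_Dvf x : dotv (nu x) ('D_v f x) = 0.
Proof. by rewrite (fr_Dvf S) dotvDr !dotvZr !frame_dot !mulr0 addr0. Qed.

Lemma dotv_Dnu_nu x w : dotv ('D_w nu x) (nu x) = 0.
Proof. exact: dotv_derive_unit smooth_nu nu_unit x w. Qed.

Lemma dotv_Dnu_f x w : dotv ('D_w nu x) (f x) = - dotv (nu x) ('D_w f x).
Proof.
by apply: (dotv_derive_cst smooth_nu sf (c := 0)) => y; rewrite frame_dot.
Qed.

Lemma Dunu_frame x : 'D_u nu x = dnu11 x *: e1 x + dnu12 x *: e2 x.
Proof.
rewrite {1}(frame_expand x ('D_u nu x)) dotv_Dnu_nu dotv_Dnu_f nu_Duf.
by rewrite oppr0 !scale0r add0r addr0.
Qed.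

Lemma Dvnu_frame x : 'D_v nu x = dnu21 x *: e1 x + dnu22 x *: e2 x.
Proof.
rewrite {1}(frame_expand x ('D_v nu x)) dotv_Dnu_nu dotv_Dnu_f nu_Dvf.
by rewrite oppr0 !scale0r add0r addr0.
Qed.

Lemma second_form x :
  [/\ dotv ('D_u ('D_u f) x) (nu x) = - (a11 x * dnu11 x),
      dotv ('D_v ('D_u f) x) (nu x) = - (a11 x * dnu21 x),
      dotv ('D_u ('D_v f) x) (nu x) = - (a21 x * dnu11 x + a22 x * dnu12 x) &
      dotv ('D_v ('D_v f) x) (nu x) = - (a21 x * dnu21 x + a22 x * dnu22 x)].
Proof.
have D w w' : (forall y, dotv (nu y) ('D_w f y) = 0) ->
    dotv ('D_w' ('D_w f) x) (nu x) = - dotv ('D_w f x) ('D_w' nu x).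
  move=> h; apply: (dotv_derive_cst (smooth_derive w sf) smooth_nu (c := 0)) => y.
  by rewrite dotvC h.
split.
- by rewrite (D u u nu_Duf) (fr_Duf S) Dunu_frame !dotvLE !frame_dot; ring.
- by rewrite (D u v nu_Duf) (fr_Duf S) Dvnu_frame !dotvLE !frame_dot; ring.
- by rewrite (D v u nu_Dvf) (fr_Dvf S) Dunu_frame !dotvLE !frame_dot; ring.
- by rewrite (D v v nu_Dvf) (fr_Dvf S) Dvnu_frame !dotvLE !frame_dot; ring.
Qed.

(** The second fundamental form is symmetric because second derivatives commute;
    its mixed coefficient has two expressions in the frame. *)
Lemma shape_sym x : a11 x * dnu21 x = a21 x * dnu11 x + a22 x * dnu12 x.
Proof.
have [_ h1 h2 _] := second_form x.
have c := congr1 (fun y => dotv y (nu x)) (derive_comm_row u v x sf).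
exact: oppr_inj (etrans (esym h1) (etrans (esym c) h2)).
Qed.

Lemma first_form x :
  [/\ dotv ('D_u f x) ('D_u f x) = a11 x ^+ 2,
      dotv ('D_u f x) ('D_v f x) = a11 x * a21 x &
      dotv ('D_v f x) ('D_v f x) = a21 x ^+ 2 + a22 x ^+ 2].
Proof. by split; rewrite ?(fr_Duf S) ?(fr_Dvf S) !dotvLE !frame_dot; ring. Qed.

Section GaussBonnet.
Context (fu_per : forall x, f (x + u) = f x) (fv_per : forall x, f (x + v) = f x).

Let connection_form w x := dotv ('D_w e1 x) (e2 x).

Lemma connection_form_periodic w p : (forall x, f (x + p) = f x) -> forall x,
  connection_form w (x + p) = connection_form w x.
Proof.
move=> fp x; rewrite /connection_form (fr_periodic fp x).2.
by rewrite (derive_periodic w (fun y => (fr_periodic fp y).1)).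
Qed.

Lemma smooth_connection_form w : smooth_on setT (connection_form w).
Proof. exact: smooth_dotv (smooth_derive w smooth_e1) smooth_e2. Qed.

(** The structure equation: the exterior derivative of the connection form is
    the Gauss curvature times the area form, and the curvature of a surface in
    the unit sphere is one plus the determinant of the shape operator. *)
Lemma gauss_equation x : 'D_v (connection_form u) x - 'D_u (connection_form v) x =
  a11 x * a22 x + (dnu11 x * dnu22 x - dnu12 x * dnu21 x).
Proof.
have se1 := smooth_e1; have se2 := smooth_e2.
have D11 w : dotv ('D_w e1 x) (e1 x) = 0.
  exact: dotv_derive_unit se1 fr_e1_unit x w.
have D22 w : dotv ('D_w e2 x) (e2 x) = 0.
  exact: dotv_derive_unit se2 fr_e2_unit x w.
have e1f y : dotv (e1 y) (f y) = 0 by rewrite frame_dot.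
have e2f y : dotv (e2 y) (f y) = 0 by rewrite frame_dot.
have e1n y : dotv (e1 y) (nu y) = 0 by rewrite frame_dot.
have e2n y : dotv (e2 y) (nu y) = 0 by rewrite frame_dot.
have uf1 : dotv ('D_u e1 x) (f x) = - a11 x.
  rewrite (dotv_derive_cst se1 sf e1f) (fr_Duf S).
  by rewrite !dotvLE !frame_dot mulr1.
have vf1 : dotv ('D_v e1 x) (f x) = - a21 x.
  rewrite (dotv_derive_cst se1 sf e1f) (fr_Dvf S).
  by rewrite !dotvLE !frame_dot mulr1 mulr0 addr0.
have uf2 : dotv ('D_u e2 x) (f x) = 0.
  rewrite (dotv_derive_cst se2 sf e2f) (fr_Duf S).
  by rewrite !dotvLE !frame_dot mulr0 oppr0.
have vf2 : dotv ('D_v e2 x) (f x) = - a22 x.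
  rewrite (dotv_derive_cst se2 sf e2f) (fr_Dvf S).
  by rewrite !dotvLE !frame_dot mulr1 mulr0 add0r.
have n1 w : dotv ('D_w e1 x) (nu x) = - dotv ('D_w nu x) (e1 x).
  by rewrite (dotvC ('D_w nu x)); exact: (dotv_derive_cst se1 smooth_nu e1n).
have n2 w : dotv ('D_w e2 x) (nu x) = - dotv ('D_w nu x) (e2 x).
  by rewrite (dotvC ('D_w nu x)); exact: (dotv_derive_cst se2 smooth_nu e2n).
have key A B p q r s : dotv A (e1 x) = 0 -> dotv B (e2 x) = 0 ->
    dotv A (f x) = p -> dotv B (f x) = q -> dotv A (nu x) = r ->
    dotv B (nu x) = s -> dotv A B = p * q + r * s.
  move=> A1 B2 Af Bf An Bn.
  by rewrite (frame_parseval x) A1 B2 Af Bf An Bn mul0r mulr0 !addr0.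
have kuv := key _ _ _ _ _ _ (D11 u) (D22 v) uf1 vf2 (n1 u) (n2 v).
have kvu := key _ _ _ _ _ _ (D11 v) (D22 u) vf1 uf2 (n1 v) (n2 u).
have cu : 'D_v (connection_form u) x = dotv ('D_v ('D_u e1) x) (e2 x) + dotv ('D_u e1 x) ('D_v e2 x).
  by apply: derive_dotv; [exact/smooth_differentiable/smooth_derive|exact: smooth_differentiable].
have cv : 'D_u (connection_form v) x = dotv ('D_u ('D_v e1) x) (e2 x) + dotv ('D_v e1 x) ('D_u e2 x).
  by apply: derive_dotv; [exact/smooth_differentiable/smooth_derive|exact: smooth_differentiable].
have c := congr1 (fun y => dotv y (e2 x)) (derive_comm_row u v x se1).
have sum (Cu Cv X Y P Q a b c' r t w z : R) : Cu = X + P -> Cv = Y + Q -> Y = X ->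
    P = - a * - b + - r * - t -> Q = - c' * 0 + - w * - z ->
    Cu - Cv = a * b + (r * t - z * w).
  by move=> -> -> -> -> ->; ring.
exact: (sum _ _ _ _ _ _ _ _ _ _ _ _ _ cu cv c kuv kvu).
Qed.

(** The frame is global on the torus, hence so is the connection form, and the
    curvature is the divergence of a periodic vector field. *)
Lemma gauss_bonnet :
  (forall x, 0 <= a11 x * a22 x + (dnu11 x * dnu22 x - dnu12 x * dnu21 x)) ->
  forall x, a11 x * a22 x + (dnu11 x * dnu22 x - dnu12 x * dnu21 x) = 0.
Proof.
move=> ge0 x.
have DN y : 'D_u (fun z => - connection_form v z) y = - 'D_u (connection_form v) y.
  rewrite -[LHS]/('D_u (- connection_form v) y) deriveN //; apply: diff_derivable.
  exact/smooth_differentiable/smooth_connection_form.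
have K y : 'D_u (fun z => - connection_form v z) y + 'D_v (connection_form u) y =
    a11 y * a22 y + (dnu11 y * dnu22 y - dnu12 y * dnu21 y).
  by rewrite -gauss_equation DN addrC.
rewrite -K; apply: periodic_divergence_eq0.
- exact/smoothN/smooth_connection_form.
- exact: smooth_connection_form.
- by move=> y; rewrite connection_form_periodic.
- by move=> y; rewrite connection_form_periodic.
- by move=> y; rewrite K.
Qed.

End GaussBonnet.
End MovingFrame.

(** * Smooth families of linear maps *)

Section ConstantFamilies.
Context {R : realType} {V : normedModType R}.

Lemma derive0_constant (g : V -> 'rV[R]_4) :
  (forall x, differentiable g x) -> (forall x w, 'D_w g x = 0) ->
  forall x y, g x = g y.
Proof.
move=> dg g0 x y; apply/rowP => i.
have dl (t : R) : is_derive t 1 (fun s => g (x + s *: (y - x)) 0 i) (cst 0 t).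
  have := is_derive_line (F := fun z => g z 0 i) (v := y - x) (x := x) (t := t)
    (differentiable_coordf i (dg _)).
  by rewrite derive_coord // g0 mxE.
have [c _] := MVT0 ltr01 dl.
rewrite scale1r scale0r addr0 (addrC x) subrK mul0r => /eqP.
by rewrite subr_eq0 => /eqP.
Qed.

Context (M : V -> 'rV[R]_4 -> 'rV[R]_4).
Context (Mlin : forall z a y y', M z (a *: y + y') = a *: M z y + M z y').
Context (Msmooth : forall y, smooth_on setT (M^~ y)).

Lemma family_sum z y : M z y = \sum_i y 0 i *: M z (delta_mx 0 i).
Proof.
have M0 : M z 0 = 0.
  by have := Mlin z (-1) 0 0; rewrite scaler0 addr0 scaleN1r addNr.
have MD a b : M z (a + b) = M z a + M z b by rewrite -{1}(scale1r a) Mlin scale1r.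
rewrite {1}(row_sum_delta y) (big_morph (M z) MD M0); apply: eq_bigr => i _.
by rewrite -[X in M z X]addr0 Mlin M0 addr0.
Qed.

Lemma derive_family (Y : V -> 'rV[R]_4) x w : smooth_on setT Y ->
  'D_w (fun z => M z (Y z)) x = 'D_w (M^~ (Y x)) x + M x ('D_w Y x).
Proof.
move=> sY.
have D (Z : V -> 'rV[R]_4) : smooth_on setT Z ->
    'D_w (fun z => M z (Z z)) x =
    \sum_i ('D_w Z x 0 i *: M x (delta_mx 0 i)
            + Z x 0 i *: 'D_w (M^~ (delta_mx 0 i)) x).
  move=> sZ.
  have dZ i : differentiable (fun z => Z z 0 i) x.
    exact/differentiable_coordf/smooth_differentiable.
  have dM i : differentiable (M^~ (delta_mx 0 i)) x by exact: smooth_differentiable.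
  have -> : (fun z => M z (Z z)) =
      \sum_i (fun z => Z z 0 i *: M z (delta_mx 0 i)).
    by apply/funext => z; rewrite fct_sumE; exact: family_sum.
  rewrite derive_sum.
    apply: eq_bigr => i _; rewrite (derive_scale w (dZ i) (dM i)).
    by rewrite derive_coord //; exact: smooth_differentiable.
  move=> i; apply: diff_derivable; apply: smooth_differentiable.
  apply: smooth_scale => // k; exact: (Ck_on_coord i openT (sZ k)).
have sc : smooth_on setT (fun _ : V => Y x) by move=> k; exact: Ck_on_cst.
apply: (etrans (D _ sY)); rewrite big_split /= addrC; congr (_ + _); last first.
  exact/esym/family_sum.
apply: (etrans _ (esym (D _ sc))); apply: eq_bigr => i _.
by rewrite derive_cst mxE scale0r add0r.
Qed.

Lemma derive_family_linear x w a y y' :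
  'D_w (M^~ (a *: y + y')) x = a *: 'D_w (M^~ y) x + 'D_w (M^~ y') x.
Proof.
have dM z : differentiable (M^~ z) x by exact: smooth_differentiable.
have -> : M^~ (a *: y + y') = a \*: M^~ y + M^~ y'.
  by apply/funext => z; rewrite Mlin.
rewrite deriveD ?deriveZ //; try exact: diff_derivable.
by apply: derivableZ; exact: diff_derivable.
Qed.

Lemma derive_dotv_family x w y z : 
  'D_w (fun t => dotv (M t y) z) x = dotv ('D_w (M^~ y) x) z.
Proof.
rewrite (derive_dotv (f := M^~ y) (g := fun=> z)).
- by rewrite derive_cst dotv0r addr0.
- exact: smooth_differentiable.
- exact: differentiable_cst.
Qed.

End ConstantFamilies.

(** The symmetric matrices (p, q; q, r) and (p', q'; q', r') anticommute with the
    reflection (al, be; be, - al), so they are multiples of its product with a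
    rotation by a right angle; the last two hypotheses express the total symmetry
    of the cubic form that they make up, which leaves no room for such multiples. *)
Lemma codazzi_algebra {R : realFieldType} (al be a b c p q r p' q' r' : R) :
  al ^+ 2 + be ^+ 2 = 1 -> 0 < a -> 0 < c ->
  al * p + be * q = 0 -> be * q - al * r = 0 -> be * (p + r) = 0 ->
  al * p' + be * q' = 0 -> be * q' - al * r' = 0 -> be * (p' + r') = 0 ->
  a * p' = b * p + c * q -> a * q' = b * q + c * r ->
  [/\ p = 0, q = 0, r = 0 & [/\ p' = 0, q' = 0 & r' = 0]].
Proof.
move=> ab1 a0 c0 h1 h2 h3 h1' h2' h3' hp hq.
have rE (x y z : R) : al * x + be * y = 0 -> be * y - al * z = 0 ->
    be * (x + z) = 0 -> z = - x.
  move=> k1 k2 k3; apply/eqP; rewrite -addr_eq0; apply/eqP.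
  rewrite -[LHS]mul1r -ab1; transitivity
    (al * ((al * x + be * y) - (be * y - al * z)) + be * (be * (x + z))); first ring.
  by rewrite k1 k2 k3; ring.
have r1 := rE _ _ _ h1 h2 h3; have r1' := rE _ _ _ h1' h2' h3'.
have l0 : al * q - be * p = 0.
  have : c * (al * q - be * p) = 0.
    transitivity (al * (b * p + c * q) + be * (b * q + c * r)
       - b * (al * p + be * q)); first by rewrite r1; ring.
    rewrite -hp -hq h1; transitivity (a * (al * p' + be * q')); first ring.
    by rewrite h1' mulr0.
  by move=> /eqP; rewrite mulf_eq0 gt_eqF //= => /eqP.
have p0 : p = 0.
  rewrite -[LHS]mul1r -ab1.
  transitivity (al * (al * p + be * q) - be * (al * q - be * p)); first ring.
  by rewrite h1 l0; ring.
have q0 : q = 0.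
  rewrite -[LHS]mul1r -ab1.
  transitivity (be * (al * p + be * q) + al * (al * q - be * p)); first ring.
  by rewrite h1 l0; ring.
have r0 : r = 0 by rewrite r1 p0 oppr0.
have p'0 : p' = 0.
  by move: hp; rewrite p0 q0 !mulr0 addr0 => /eqP; rewrite mulf_eq0 gt_eqF //= => /eqP.
have q'0 : q' = 0.
  by move: hq; rewrite q0 r0 !mulr0 addr0 => /eqP; rewrite mulf_eq0 gt_eqF //= => /eqP.
by split=> //; split=> //; rewrite r1' p'0 oppr0.
Qed.

(** * Flat minimal surfaces *)

Section FlatMinimal.
Context {R : realType} {V : normedModType R} {u v : V} (S : framed_surface u v).
Context (span : forall w : V, exists a b : R, w = a *: u + b *: v).
Local Notation f := (fr_f S).
Local Notation e1 := (fr_e1 S).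
Local Notation e2 := (fr_e2 S).
Local Notation nu := (fr_nu S).
Local Notation a11 := (fr_a11 S).
Local Notation a21 := (fr_a21 S).
Local Notation a22 := (fr_a22 S).
Context (flat : forall x,
  a11 x * a22 x + (dnu11 S x * dnu22 S x - dnu12 S x * dnu21 S x) = 0).
Context (minimal : forall x,
  a22 x * dnu11 S x + a11 x * dnu22 S x - a21 x * dnu12 S x = 0).

Definition shape1 x := dnu11 S x / a11 x.
Definition shape2 x := dnu12 S x / a11 x.

(** The shape operator is symmetric and, by minimality, traceless: in the
    orthonormal frame its matrix is (shape1, shape2; shape2, - shape1). *)
Lemma Dnu_shape x :
  'D_u nu x = a11 x *: (shape1 x *: e1 x + shape2 x *: e2 x) /\
  'D_v nu x = a21 x *: (shape1 x *: e1 x + shape2 x *: e2 x)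
            + a22 x *: (shape2 x *: e1 x - shape1 x *: e2 x).
Proof.
have a1 : a11 x != 0 by rewrite gt_eqF // fr_a11_gt0.
have E1 : a11 x * shape1 x = dnu11 S x by rewrite /shape1; field.
have E2 : a11 x * shape2 x = dnu12 S x by rewrite /shape2; field.
have sym := shape_sym S x; have tr := minimal x.
have E3 : a21 x * shape1 x + a22 x * shape2 x = dnu21 S x.
  by apply: (mulfI a1); rewrite sym -E1 -E2; ring.
have E4 : a21 x * shape2 x - a22 x * shape1 x = dnu22 S x.
  apply: (mulfI a1); apply/eqP; rewrite -subr_eq0; apply/eqP.
  by rewrite -oppr0 -[in RHS]tr -E1 -E2; ring.
split.
  by rewrite Dunu_frame -E1 -E2 scalerDr !scalerA.
rewrite Dvnu_frame -E3 -E4 !scalerDr !scalerN !scalerA scalerBl !scalerDl.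
rewrite -!addrA; congr (_ + _); rewrite !addrA; congr (_ + _).
by rewrite addrC.
Qed.

(** Flatness makes the determinant of the shape operator equal to -1. *)
Lemma shape_unit x : shape1 x ^+ 2 + shape2 x ^+ 2 = 1.
Proof.
have a1 : a11 x != 0 by rewrite gt_eqF // fr_a11_gt0.
have a2 : a22 x != 0 by rewrite gt_eqF // fr_a22_gt0.
have E1 : dnu11 S x = a11 x * shape1 x by rewrite /shape1; field.
have E2 : dnu12 S x = a11 x * shape2 x by rewrite /shape2; field.
have sym := shape_sym S x; have tr := minimal x; have K := flat x.
have : a11 x * a22 x * (1 - (shape1 x ^+ 2 + shape2 x ^+ 2)) = 0.
  rewrite -[RHS]K; apply: (mulfI a1).
  transitivity (a11 x * (a11 x * a22 x) + ((dnu11 S x) * (a21 x * dnu12 S x - a22 x * dnu11 S x)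
     - dnu12 S x * (a21 x * dnu11 S x + a22 x * dnu12 S x))).
    by rewrite E1 E2; ring.
  rewrite -sym; transitivity (a11 x * (a11 x * a22 x) + (dnu11 S x * (a11 x * dnu22 S x)
     - dnu12 S x * (a11 x * dnu21 S x))); last ring.
  congr (_ + (dnu11 S x * _ - _)); apply/eqP; rewrite -subr_eq0; apply/eqP.
  by rewrite -oppr0 -[in RHS]tr; ring.
by move=> /eqP; rewrite !mulf_eq0 (negPf a1) (negPf a2) /= subr_eq0 => /eqP.
Qed.

(** The linear involution of the ambient space exchanging position and normal
    and acting on the tangent plane as the differential of the normal.  For the
    Clifford torus it is, up to sign, the reflection (z, w) |-> (z, - w). *)
Definition invol x (y : 'rV[R]_4) : 'rV[R]_4 :=
  dotv y (nu x) *: f x + dotv y (f x) *: nu x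
  + dotv y (e1 x) *: (shape1 x *: e1 x + shape2 x *: e2 x)
  + dotv y (e2 x) *: (shape2 x *: e1 x - shape1 x *: e2 x).

Lemma invol_linear x a y y' : invol x (a *: y + y') = a *: invol x y + invol x y'.
Proof.
rewrite /invol !(dotvDl, dotvZl).
by apply/rowP => i; rewrite !mxE; ring.
Qed.

Lemma invol_f x : invol x (f x) = nu x.
Proof. by rewrite /invol !(frame_dot S) !scale0r scale1r add0r !addr0. Qed.

Lemma invol_nu x : invol x (nu x) = f x.
Proof. by rewrite /invol !(frame_dot S) !scale0r scale1r !addr0. Qed.

Lemma invol_e1 x : invol x (e1 x) = shape1 x *: e1 x + shape2 x *: e2 x.
Proof. by rewrite /invol !(frame_dot S) !scale0r scale1r !add0r addr0. Qed.

Lemma invol_e2 x : invol x (e2 x) = shape2 x *: e1 x - shape1 x *: e2 x.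
Proof. by rewrite /invol !(frame_dot S) !scale0r scale1r !add0r. Qed.

(** The sign is such that the involution maps velocities of the position to
    velocities of the normal, just as it maps the position to the normal. *)
Lemma invol_Df x w : invol x ('D_w f x) = 'D_w nu x.
Proof.
have ml y y' a b : invol x (a *: y + b *: y') = a *: invol x y + b *: invol x y'.
  rewrite invol_linear -[b *: y' in LHS]addr0 invol_linear.
  suff -> : invol x 0 = 0 by rewrite addr0.
  by rewrite /invol !dotv0l !scale0r !addr0.
have [Du Dv] := Dnu_shape x.
have iu : invol x ('D_u f x) = 'D_u nu x.
  by rewrite fr_Duf Du -[a11 x *: e1 x]addr0 -(scale0r (e2 x)) ml invol_e1 scale0r addr0.
have iv : invol x ('D_v f x) = 'D_v nu x.
  by rewrite fr_Dvf Dv ml invol_e1 invol_e2.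
have [a [b ->]] := span w.
rewrite !derive_linear; last exact: smooth_differentiable (fr_sf S).
  by rewrite ml iu iv.
exact: smooth_differentiable (fr_snu S).
Qed.

Lemma invol_sym x y y' : dotv (invol x y) y' = dotv y (invol x y').
Proof. by rewrite /invol !(dotvLE) !(dotvC _ y'); ring. Qed.

Lemma invol_iso x y y' : dotv (invol x y) (invol x y') = dotv y y'.
Proof.
rewrite (frame_parseval S x y y').
transitivity (dotv y (f x) * dotv y' (f x) + dotv y (nu x) * dotv y' (nu x)
  + (shape1 x ^+ 2 + shape2 x ^+ 2) * (dotv y (e1 x) * dotv y' (e1 x)
      + dotv y (e2 x) * dotv y' (e2 x))); last by rewrite shape_unit; ring.
by rewrite {1 2}/invol !dotvLE !(frame_dot S); ring.
Qed.

Lemma involK x y : invol x (invol x y) = y.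
Proof.
apply/eqP; rewrite -subr_eq0; apply/eqP/dotv_eq0.
set d := invol x (invol x y) - y.
have dz z : dotv d z = 0.
  by rewrite /d dotvDl dotvNl invol_sym invol_iso subrr.
exact: dz.
Qed.

Lemma smooth_invol y : smooth_on setT (invol^~ y).
Proof.
have [sf se1 se2 sn] := And4 (fr_sf S) (fr_se1 S) (fr_se2 S) (fr_snu S).
have sc : smooth_on setT (fun _ : V => y) by move=> k; exact: Ck_on_cst.
have sa : smooth_on setT (fun x => (a11 x)^-1).
  apply: smoothV => [x|]; first by rewrite gt_eqF // fr_a11_gt0.
  have -> : a11 = fun x => dotv ('D_u f x) (e1 x).
    by apply/funext => x; rewrite fr_Duf dotvZl (frame_dot S) mulr1.
  exact: smooth_dotv (smooth_derive u sf) se1.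
have s1 : smooth_on setT shape1.
  exact: smoothM (smooth_dotv (smooth_derive u sn) se1) sa.
have s2 : smooth_on setT shape2.
  exact: smoothM (smooth_dotv (smooth_derive u sn) se2) sa.
have sd (g : V -> 'rV[R]_4) : smooth_on setT g -> smooth_on setT (fun x => dotv y (g x)).
  by move=> sg; exact: (smooth_dotv (f := fun=> y) sc sg).
have sN (g : V -> 'rV[R]_4) : smooth_on setT g -> smooth_on setT (fun x => - (shape1 x *: g x)).
  move=> sg; have -> : (fun x => - (shape1 x *: g x)) = (fun x => (- shape1 x) *: g x).
    by apply/funext => x; rewrite scaleNr.
  by apply: smooth_scale => //; exact: smoothN.
have n1 := smoothD (smooth_scale s1 se1) (smooth_scale s2 se2).
have n2 := smoothD (smooth_scale s2 se1) (sN _ se2).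
exact: smoothD (smoothD (smoothD (smooth_scale (sd _ sn) sf) (smooth_scale (sd _ sf) sn))
  (smooth_scale (sd _ se1) n1)) (smooth_scale (sd _ se2) n2).
Qed.

(** Differentiating the relation that the involution maps position to normal; the
    terms where the vectors are differentiated cancel. *)
Lemma derive_invol_f x w : 'D_w (invol^~ (f x)) x = 0.
Proof.
have := derive_family invol_linear smooth_invol x w (fr_sf S).
have -> : (fun z => invol z (f z)) = nu by apply/funext => z; exact: invol_f.
by rewrite invol_Df -[X in X = _ -> _]add0r => /addIr /esym.
Qed.

Lemma derive_invol_nu x w : 'D_w (invol^~ (nu x)) x = 0.
Proof.
have := derive_family invol_linear smooth_invol x w (fr_snu S).
have -> : (fun z => invol z (nu z)) = f by apply/funext => z; exact: invol_nu.
by rewrite -invol_Df involK -[X in X = _ -> _]add0r => /addIr /esym.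
Qed.

Lemma derive_invol_sym x w y y' :
  dotv ('D_w (invol^~ y) x) y' = dotv y ('D_w (invol^~ y') x).
Proof.
rewrite -(derive_dotv_family smooth_invol) (dotvC y).
rewrite -(derive_dotv_family smooth_invol).
have -> // : (fun t => dotv (invol t y) y') = (fun t => dotv (invol t y') y).
by apply/funext => t; rewrite invol_sym dotvC.
Qed.

Lemma derive_invol_anticomm x w y y' :
  dotv ('D_w (invol^~ y) x) (invol x y') = - dotv (invol x y) ('D_w (invol^~ y') x).
Proof.
exact: (dotv_derive_cst (smooth_invol y) (smooth_invol y') (fun z => invol_iso z y y')).
Qed.

(** The Codazzi equation: either side is a mixed second derivative of the normal
    minus the involution applied to a mixed second derivative of the position. *)
Lemma derive_invol_codazzi x :
  'D_v (invol^~ ('D_u f x)) x = 'D_u (invol^~ ('D_v f x)) x.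
Proof.
have sDf w := smooth_derive w (fr_sf S).
have inv w : (fun z => invol z ('D_w f z)) = 'D_w nu.
  by apply/funext => z; exact: invol_Df.
have Eu := derive_family invol_linear smooth_invol x v (sDf u).
have Ev := derive_family invol_linear smooth_invol x u (sDf v).
have iu := congr1 (fun g : V -> 'rV[R]_4 => 'D_v g x) (inv u).
have iv := congr1 (fun g : V -> 'rV[R]_4 => 'D_u g x) (inv v).
have cf := congr1 (invol x) (derive_comm_row v u x (fr_sf S)).
have cn := derive_comm_row v u x (fr_snu S).
apply: (addIr (invol x ('D_v ('D_u f) x))).
have Eu' := etrans (esym iu) Eu; have Ev' := etrans (esym iv) Ev.
exact: etrans (esym Eu') (etrans cn (etrans Ev' (congr1 _ (esym cf)))).
Qed.

(** The derivative of the involution kills position and normal, is symmetric, and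
    anticommutes with the involution; on the tangent plane it is, by the Codazzi
    equation, a totally symmetric cubic form.  These constraints force it to
    vanish. *)
Lemma derive_invol_eq0 x w y : 'D_w (invol^~ y) x = 0.
Proof.
pose N w y := 'D_w (invol^~ y) x.
have Nlin w' a z z' : N w' (a *: z + z') = a *: N w' z + N w' z'.
  exact: derive_family_linear invol_linear smooth_invol x w' a z z'.
have N0 w' : N w' 0 = 0.
  by have := Nlin w' (-1) 0 0; rewrite scaler0 addr0 scaleN1r addNr.
have NZ w' a z : N w' (a *: z) = a *: N w' z by rewrite -[a *: z]addr0 Nlin N0 addr0.
have NN w' a b z z' : N w' (a *: z + b *: z') = a *: N w' z + b *: N w' z'.
  by rewrite Nlin NZ.
have Nf w' : N w' (f x) = 0 by exact: derive_invol_f.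
have Nnu w' : N w' (nu x) = 0 by exact: derive_invol_nu.
have Nsym w' z z' : dotv (N w' z) z' = dotv z (N w' z') by exact: derive_invol_sym.
have Nanti w' z z' : dotv (N w' z) (invol x z') = - dotv (invol x z) (N w' z').
  exact: derive_invol_anticomm.
have Ncod : N v ('D_u f x) = N u ('D_v f x) by exact: derive_invol_codazzi.
suff [Nu Nv] : N u y = 0 /\ N v y = 0.
  have [a [b ->]] := span w.
  rewrite derive_linear; last exact: smooth_differentiable (smooth_invol y).
  exact: etrans (congr2 (fun s t => a *: s + b *: t) Nu Nv) (etrans (congr2 +%R (scaler0 _ _) (scaler0 _ _)) (addr0 _)).
move: N Nlin N0 NZ NN Nf Nnu Nsym Nanti Ncod => N.
move=> Nlin N0 NZ NN Nf Nnu Nsym Nanti Ncod.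
pose p w' := dotv (N w' (e1 x)) (e1 x).
pose q w' := dotv (N w' (e1 x)) (e2 x).
pose r w' := dotv (N w' (e2 x)) (e2 x).
have q' w' : dotv (N w' (e2 x)) (e1 x) = q w' by rewrite Nsym dotvC.
have c1 w' : shape1 x * p w' + shape2 x * q w' = 0.
  have := Nanti w' (e1 x) (e1 x); rewrite (dotvC (invol x _)) => /eqP.
  rewrite -addr_eq0 -mulr2n mulrn_eq0 /= invol_e1 dotvDr !dotvZr => /eqP.
  exact.
have c2 w' : shape2 x * q w' - shape1 x * r w' = 0.
  have := Nanti w' (e2 x) (e2 x); rewrite (dotvC (invol x _)) => /eqP.
  rewrite -addr_eq0 -mulr2n mulrn_eq0 /= invol_e2 dotvDr dotvNr !dotvZr q' => /eqP.
  exact.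
have c3 w' : shape2 x * (p w' + r w') = 0.
  have := Nanti w' (e1 x) (e2 x); rewrite (dotvC (invol x _)) invol_e1 invol_e2.
  rewrite !dotvDr dotvNr !dotvZr q' -/(p w') -/(q w') -/(r w') => /eqP.
  by rewrite -subr_eq0 opprK => /eqP h; rewrite -[RHS]h; ring.
move: Ncod; rewrite fr_Duf fr_Dvf NZ NN => Ncod.
have c4 : a11 x * p v = a21 x * p u + a22 x * q u.
  have := congr1 (fun z => dotv z (e1 x)) Ncod.
  by rewrite dotvDl !dotvZl q'.
have c5 : a11 x * q v = a21 x * q u + a22 x * r u.
  have := congr1 (fun z => dotv z (e2 x)) Ncod.
  by rewrite dotvDl !dotvZl.
have [pu qu ru [pv qv rv]] := codazzi_algebra (shape_unit x) (fr_a11_gt0 S x)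
  (fr_a22_gt0 S x) (c1 u) (c2 u) (c3 u) (c1 v) (c2 v) (c3 v) c4 c5.
have N1 w' : p w' = 0 -> q w' = 0 -> N w' (e1 x) = 0.
  move=> pw qw; rewrite (frame_expand S x (N w' (e1 x))) -/(p w') -/(q w') pw qw.
  by rewrite !Nsym Nf Nnu !dotv0r !scale0r !addr0.
have N2 w' : q w' = 0 -> r w' = 0 -> N w' (e2 x) = 0.
  move=> qw rw; rewrite (frame_expand S x (N w' (e2 x))) -/(r w') q' qw rw.
  by rewrite !Nsym Nf Nnu !dotv0r !scale0r !addr0.
have Ny w' : N w' (e1 x) = 0 -> N w' (e2 x) = 0 -> N w' y = 0.
  move=> n1 n2; rewrite (frame_expand S x y).
  have ND z z' : N w' (z + z') = N w' z + N w' z' by rewrite -(scale1r z) Nlin !scale1r.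
  by rewrite !ND !NZ Nf Nnu n1 n2 !scaler0 !addr0.
by split; apply: Ny; [exact: N1|exact: N2|exact: N1|exact: N2].
Qed.

Lemma invol_constant x x' y : invol x y = invol x' y.
Proof.
apply: (derive0_constant (g := invol^~ y)) => [z|z w].
  exact: smooth_differentiable (smooth_invol y).
exact: derive_invol_eq0.
Qed.

End FlatMinimal.

(** * Maximum tests and the topology of the torus *)

Section Tests.
Context {R : realType}.

Lemma differentiable_near {V : normedModType R} (g : V -> R) (x : V) (eta : R) :
  differentiable g x -> 0 < eta ->
  exists2 d : R, 0 < d & forall h : V, `|h| < d ->
    `|g (x + h) - g x - 'D_h g x| <= eta * `|h|.
Proof.
move=> dg eta0; have /eqaddoP/(_ _ eta0) := diff_locally dg.
move=> /nbhs_normP[d /= d0 dP]; exists d => // h hd.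
have := dP h; rewrite /= sub0r normrN => /(_ hd).
by rewrite !fctE /= opprD addrA (addrC h) deriveE.
Qed.

Lemma norm_sub_continuous {V W : normedModType R} (g : V -> W) (w : W) :
  continuous g -> continuous (fun y => `|g y - w|).
Proof. by move=> cg y; apply: cvg_norm; apply: cvgB; [exact: cg|exact: cvg_cst]. Qed.

Lemma max_derivative_tests (phi dphi : R -> R) (c : R) :
  (forall t : R, is_derive t 1 phi (dphi t)) -> is_derive (0 : R) 1 dphi c ->
  (forall t, phi t <= phi 0) -> dphi 0 = 0 /\ c <= 0.
Proof.
move=> hphi hd max0.
have dphi0 : dphi 0 = 0.
  have h : is_derive (0 : R) 1 phi 0.
    apply: (@derive1_at_max _ phi (-1) 1) => //.
    by rewrite in_itv /= ltrN10 ltr01.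
  by have [_ <-] := hphi 0; have [_ ->] := h.
split=> //; rewrite leNgt; apply/negP => c0.
have dd : differentiable dphi 0 by apply/derivable1_diffP; have [] := hd.
have c2 : 0 < c / 2 by rewrite divr_gt0.
have [d d0 dP] := differentiable_near dd c2.
have Dh (h : R) : 'D_h dphi 0 = h * c.
  rewrite deriveE // -[X in 'd _ _ X]mulr1 -[X in 'd _ _ X]/(h *: 1) linearZ /=.
  by rewrite -deriveE //; have [_ ->] := hd.
have pos t : 0 < t < d -> 0 < dphi t.
  move=> /andP[t0 td]; have := dP t; rewrite gtr0_norm // => /(_ td).
  rewrite add0r dphi0 subr0 Dh ler_norml => /andP[+ _].
  rewrite lerBrDr; apply: lt_le_trans.
  by rewrite addrC [t * c]mulrC -mulrBl mulr_gt0 // subr_gt0 ltr_pdivrMr // ltr_pMr // ltr1n.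
have d2 : 0 < d / 2 by rewrite divr_gt0.
have [x /andP[x0 xd] E] := MVT0 d2 hphi.
have := max0 (d / 2); rewrite -subr_le0 E leNgt mulr_gt0 // pos // x0 /=.
by rewrite (lt_trans xd) // ltr_pdivrMr // ltr_pMr // ltr1n.
Qed.

(** At a global maximum of a height function on the surface, the velocity is
    orthogonal to the height direction and the acceleration points down. *)
Lemma max_along_lines {V : normedModType R} (f : V -> 'rV[R]_4) (c : 'rV[R]_4) (x : V) :
  smooth_on setT f -> (forall y, dotv (f y) c <= dotv (f x) c) ->
  forall w, dotv ('D_w f x) c = 0 /\ dotv ('D_w ('D_w f) x) c <= 0.
Proof.
move=> sf max0 w.
pose phi (t : R) := dotv (f (x + t *: w)) c.
have D (g : V -> 'rV[R]_4) (t : R) : smooth_on setT g ->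
    is_derive t 1 (fun s => dotv (g (x + s *: w)) c) (dotv ('D_w g (x + t *: w)) c).
  move=> sg.
  have sgc : smooth_on setT (fun y => dotv (g y) c).
    by apply: (smooth_dotv (g := fun=> c)) => // k; exact: Ck_on_cst.
  have := is_derive_line (F := fun y => dotv (g y) c) (v := w) (x := x) (t := t)
    (smooth_differentiable _ sgc).
  rewrite (derive_dotv (g := fun=> c)).
  - by rewrite derive_cst dotv0r addr0.
  - exact: smooth_differentiable.
  - exact: differentiable_cst.
have h0 := D ('D_w f) 0 (smooth_derive w sf).
have mx t : phi t <= phi 0 by rewrite /phi scale0r addr0.
have := max_derivative_tests (fun t => D f t sf) h0 mx.
by rewrite scale0r addr0.
Qed.

End Tests.

Section TorusTopology.
Context {R : realType}.
Implicit Types x y : 'rV[R]_2.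

Definition coord_u : 'rV[R]_2 := delta_mx 0 0.
Definition coord_v : 'rV[R]_2 := delta_mx 0 1.

Lemma coord_span w : exists a b : R, w = a *: coord_u + b *: coord_v.
Proof.
exists (w 0 0), (w 0 1); rewrite {1}(row_sum_delta w) big_ord_recl big_ord1.
by congr (_ *: delta_mx 0 _ + w 0 _ *: delta_mx 0 _); apply/val_inj.
Qed.

Definition cell x : set 'rV[R]_2 :=
  [set y | forall i, `[x 0 i - 1 / 2, x 0 i + 1 / 2]%classic (y 0 i)].

Lemma cell_compact x : compact (cell x).
Proof.
apply: (@rV_compact _ _ (fun i => `[x 0 i - 1 / 2, x 0 i + 1 / 2]%classic)) => i.
exact: segment_compact.
Qed.

Lemma cellxx x : cell x x.
Proof. by move=> i; rewrite /= in_itv /=; apply/andP; split; lra. Qed.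

(** Rounding each coordinate to the nearest integer. *)
Lemma cell_translate x y : exists k : 'rV[int]_2, cell x (y + map_mx intr k).
Proof.
exists (\row_i (- Num.floor (y 0 i - x 0 i + 1 / 2))) => i.
rewrite /= in_itv /= !mxE intrN.
have := floor_itv (y 0 i - x 0 i + 1 / 2); rewrite intrD => /andP[h1 h2].
by move: h1 h2; move: ((Num.floor _)%:~R : R) => z h1 h2; apply/andP; split; lra.
Qed.

Context (f : 'rV[R]_2 -> 'rV[R]_4) (hf : torus_embedding f).

Lemma torus_smooth : smooth_on setT f. Proof. by have [] := hf. Qed.

Lemma torus_unit x : dotv (f x) (f x) = 1.
Proof. by have [_ _ _ /(_ x)/S3E] := hf. Qed.

Lemma torus_periodic x (k : 'rV[int]_2) : f (x + map_mx intr k) = f x.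
Proof. by have [_ fk _ _] := hf; apply/esym/fk; exists k. Qed.

Lemma torus_periodic_u x : f (x + coord_u) = f x.
Proof.
rewrite -[RHS](torus_periodic x (delta_mx 0 0)); congr (f (_ + _)).
by apply/rowP => i; rewrite !mxE; case: (_ && _).
Qed.

Lemma torus_periodic_v x : f (x + coord_v) = f x.
Proof.
rewrite -[RHS](torus_periodic x (delta_mx 0 1)); congr (f (_ + _)).
by apply/rowP => i; rewrite !mxE; case: (_ && _).
Qed.

Lemma torus_immersion x (a b : R) :
  a *: 'D_coord_u f x + b *: 'D_coord_v f x = 0 -> a = 0 /\ b = 0.
Proof.
have [sf _ imm _] := hf; rewrite -derive_linear; last exact: smooth_differentiable.
move=> /imm ab0.
split; [have := congr1 (fun w : 'rV[R]_2 => w 0 0) ab0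
       |have := congr1 (fun w : 'rV[R]_2 => w 0 1) ab0].
  by rewrite !mxE /= mulr1 mulr0 addr0.
by rewrite !mxE /= mulr1 mulr0 add0r.
Qed.

Lemma torus_continuous : continuous f.
Proof. by move=> x; apply: differentiable_continuous; exact: smooth_differentiable torus_smooth. Qed.

Lemma dotv_continuous (c : 'rV[R]_4) : continuous (fun y => dotv (f y) c).
Proof.
move=> x; apply: differentiable_continuous; apply: smooth_differentiable.
by apply: (smooth_dotv (g := fun=> c)) torus_smooth _ => k; exact: Ck_on_cst.
Qed.

Lemma torus_max (c : 'rV[R]_4) : exists x, forall y, dotv (f y) c <= dotv (f x) c.
Proof.
have [x _ xP] := EVT_max_rV (ex_intro _ _ (cellxx 0)) (@cell_compact 0) (continuous_subspaceT (@dotv_continuous c)).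
exists x => y; have [k yk] := cell_translate 0 y.
by rewrite -(torus_periodic y k); apply: xP; rewrite inE.
Qed.

(** The parametrization is a homeomorphism of the torus onto its image, by
    compactness of the cell centred at [x]: the only point of that cell congruent
    to [x] is [x] itself. *)
Lemma torus_close x (e : R) : 0 < e -> exists2 d : R, 0 < d &
  forall y, `|f y - f x| < d -> exists k : 'rV[int]_2, `|y + map_mx intr k - x| < e.
Proof.
move=> e0; pose K := cell x `&` [set y | e <= `|y - x|].
have cK : compact K.
  apply: compact_closedI; first exact: cell_compact.
  have cn : continuous (fun y : 'rV[R]_2 => `|y - x|).
    by apply: (norm_sub_continuous (g := id)) => y; exact: cvg_id.
  exact: ((continuous_closedP _).1 cn _ (@closed_ge R e)).
(* Two points of the cell whose difference is an integer vector: the difference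
   is at most 1/2 in each coordinate. *)
have noK y : K y -> 0 < `|f y - f x|.
  move=> [cy /= ey]; rewrite normr_gt0 subr_eq0; apply/eqP => fyx.
  have [_ /(_ y x)[/(_ fyx)[k xk] _] _ _] := hf.
  have yx0 : y - x = 0.
    rewrite xk opprD addNKr; apply/rowP => i; rewrite !mxE.
    have := cy i; rewrite xk /= in_itv /= !mxE => /andP[h1 h2].
    have : `|k 0 i| < 1.
      rewrite -(ltr_int R) intr_norm ltr_norml; apply/andP; split; lra.
    by move=> k1; have -> : k 0 i = 0; [lia|rewrite oppr0].
  by move: ey; rewrite yx0 normr0 leNgt e0.
have cfK : continuous (fun y => `|f y - f x|).
  exact: norm_sub_continuous torus_continuous.
have cell_in d : (forall y, K y -> d <= `|f y - f x|) -> forall y, `|f y - f x| < d ->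
    exists k : 'rV[int]_2, `|y + map_mx intr k - x| < e.
  move=> dK y yd; have [k yk] := cell_translate x y; exists k.
  rewrite ltNge; apply/negP => ke.
  by have := dK _ (conj yk ke); rewrite torus_periodic leNgt yd.
have [K0|/set0P/negP/negPn/eqP K0] := pselect (K !=set0).
  have [c] := EVT_min_rV K0 cK (continuous_subspaceT cfK).
  rewrite inE => Kc cP; exists `|f c - f x|; first exact: noK.
  by apply: cell_in => y Ky; apply: cP; rewrite inE.
by exists 1 => //; apply: cell_in => y; rewrite K0.
Qed.

End TorusTopology.

(** * Normals of an embedded torus *)

(** The dual basis of the coordinate tangent vectors, read off the triangular
    matrix of the frame. *)
Lemma frame_dual {R : realType} {V : normedModType R} {u v : V}
    (S : framed_surface u v) x : exists E1 E2 : 'rV[R]_4,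
  [/\ dotv ('D_u (fr_f S) x) E1 = 1, dotv ('D_v (fr_f S) x) E1 = 0,
      dotv ('D_u (fr_f S) x) E2 = 0 & dotv ('D_v (fr_f S) x) E2 = 1].
Proof.
have a1 : fr_a11 S x != 0 by rewrite gt_eqF // fr_a11_gt0.
have a2 : fr_a22 S x != 0 by rewrite gt_eqF // fr_a22_gt0.
pose E2 := (fr_a22 S x)^-1 *: fr_e2 S x.
pose E1 := (fr_a11 S x)^-1 *: (fr_e1 S x + (- fr_a21 S x) *: E2).
exists E1, E2; rewrite fr_Duf fr_Dvf /E1 /E2 !dotvLE !(frame_dot S).
by split; field; rewrite ?a1 ?a2.
Qed.

Section TorusNormals.
Context {R : realType} (f : 'rV[R]_2 -> 'rV[R]_4) (hf : torus_embedding f).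

Definition torus_frame : framed_surface coord_u coord_v :=
  frame_of_immersion (torus_smooth hf) (torus_unit hf) (torus_immersion hf).

Lemma rV_norm_le n (x : 'rV[R]_n) (e : R) : 0 <= e -> (forall i, `|x 0 i| <= e) -> `|x| <= e.
Proof.
move=> e0 xe; rewrite [leLHS]/Num.Def.normr /= mx_normrE.
by apply: bigmax_le => // -[i j] _ /=; rewrite ord1.
Qed.

Lemma dual_tangent x : exists E : 'I_2 -> 'rV[R]_4,
  forall i h, dotv ('D_h f x) (E i) = h 0 i.
Proof.
have [E1 [E2 [u1 v1 u2 v2]]] := frame_dual torus_frame x.
exists (fun i => if i == 0 then E1 else E2) => i h.
have [a [b hab]] := coord_span h.
have h0 : h 0 0 = a by rewrite hab !mxE /= mulr1 mulr0 addr0.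
have h1 : h 0 1 = b by rewrite hab !mxE /= mulr1 mulr0 add0r.
rewrite {1}hab derive_linear; last exact: smooth_differentiable (torus_smooth hf).
have DXY (X Y E : 'rV[R]_4) (p q : R) : dotv X E = p -> dotv Y E = q ->
    dotv (a *: X + b *: Y) E = a * p + b * q.
  by move=> <- <-; rewrite dotvDl !dotvZl.
case: eqVneq => [->|i0]; first by apply: etrans (DXY _ _ _ _ _ u1 v1) _; rewrite h0; ring.
have -> : i = 1 by case: i i0 => -[|[|//]] //= ? _; exact/val_inj.
by apply: etrans (DXY _ _ _ _ _ u2 v2) _; rewrite h1; ring.
Qed.

Lemma curve_near (e : R) (gamma : R -> 'rV[R]_4) (z : 'rV[R]_4) (eta : R) :
  0 < e -> smooth_on `]- e, e[%classic gamma -> 0 < eta ->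
  exists2 d : R, 0 < d & forall t : R, 0 < t < d ->
    `|dotv (gamma t - gamma 0) z - t * dotv (derive1 gamma 0) z| <= eta * t.
Proof.
move=> e0 sg eta0.
have dg : differentiable gamma 0.
  by have [+ _] := sg 1%N; apply; rewrite /= in_itv /= oppr_lt0 e0.
have dz : differentiable (fun t => dotv (gamma t) z) 0.
  rewrite /dotv.
  have -> : (fun t => \sum_(i < 4) gamma t 0 i * z 0 i) =
     \sum_(i < 4) ((fun t => gamma t 0 i) * (fun=> z 0 i)).
    by apply/funext => t; rewrite fct_sumE.
  apply: differentiable_sum => i; apply: differentiableM.
    exact: differentiable_coordf.
  exact: differentiable_cst.
have [d d0 dP] := differentiable_near dz eta0.
exists d => // t /andP[t0 td]; have := dP t; rewrite gtr0_norm // add0r => /(_ td).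
suff -> : 'D_t (fun t => dotv (gamma t) z) 0 = t * dotv (derive1 gamma 0) z.
  by rewrite dotvDl dotvNl.
rewrite (derive_dotv (g := fun=> z) _ dg (differentiable_cst _ _)).
rewrite derive_cst dotv0r addr0 derive1E !deriveE //.
by rewrite -{1}[t]mulr1 -[t * 1]/(t *: 1) linearZ dotvZl.
Qed.

(** Velocities of curves lying in the torus are tangent to the parametrization:
    a curve in the image lifts, near its starting point, to points of the
    parameter plane whose displacement is controlled by time. *)
Lemma tangent_vector_orth x (n w : 'rV[R]_4) :
  (forall h, dotv ('D_h f x) n = 0) -> tangent_vector (range f) (f x) w ->
  dotv w n = 0.
Proof.
move=> fn [e [gamma [e0 sg gS g0 gw]]].
have [E EP] := dual_tangent x.
pose A := `|dotv w (E 0)| + `|dotv w (E 1)| + 1.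
have A0 : 0 < A by rewrite ltr_wpDl // addr_ge0.
(* Letting [eta] go to zero. *)
suff bound (eta : R) : 0 < eta -> `|dotv w n| <= (2 * A + 1) * eta.
  apply/eqP; rewrite -normr_le0 leNgt; apply/negP => n0.
  have B0 : 0 < 2 * A + 1 by rewrite addr_gt0 ?mulr_gt0.
  have := bound (`|dotv w n| / (2 * A + 1) / 2).
  rewrite !divr_gt0 // => /(_ isT); rewrite mulrA mulrCA divff ?gt_eqF // mulr1.
  by rewrite leNgt ltr_pdivrMr // ltr_pMr // ltr1n.
move=> eta0.
have dz z : differentiable (fun y => dotv (f y) z) x.
  apply: smooth_differentiable; apply: (smooth_dotv (g := fun=> z)); first exact: torus_smooth.
  by move=> k; exact: Ck_on_cst.
have Dz z h : 'D_h (fun y => dotv (f y) z) x = dotv ('D_h f x) z.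
  rewrite (derive_dotv (g := fun=> z)).
  - by rewrite derive_cst dotv0r addr0.
  - exact: smooth_differentiable (torus_smooth hf).
  - exact: differentiable_cst.
have h2 : 0 < (1 / 2 : R) by lra.
have [d1 d10 d1P] := differentiable_near (dz (E 0)) h2.
have [d2 d20 d2P] := differentiable_near (dz (E 1)) h2.
have [d3 d30 d3P] := differentiable_near (dz n) eta0.
pose eps := Num.min d1 (Num.min d2 d3).
have eps0 : 0 < eps by rewrite !lt_min d10 d20 d30.
have [del del0 delP] := torus_close hf x eps0.
have [t1 t10 t1P] := curve_near (E 0) e0 sg ltr01.
have [t2 t20 t2P] := curve_near (E 1) e0 sg ltr01.
have [t3 t30 t3P] := curve_near n e0 sg eta0.
have cg : {for 0, continuous gamma}.
  by apply: (sg 0%N); rewrite /= in_itv /= oppr_lt0 e0.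
have /cvgr_dist_lt/(_ _ del0)/nbhs_normP[t4 /= t40 t4P] := cg.
(* A time so short that all first order expansions apply. *)
pose tm := Num.min (Num.min (Num.min t1 t2) (Num.min t3 t4)) e.
have tm0 : 0 < tm by rewrite !lt_min t10 t20 t30 t40 e0.
pose t := tm / 2.
have t0 : 0 < t by rewrite divr_gt0.
have : t < tm by rewrite ltr_pdivrMr // ltr_pMr // ltr1n.
rewrite !lt_min => /andP[/andP[/andP[tt1 tt2] /andP[tt3 tt4]] te].
have [y _ yE] : range f (gamma t).
  by apply: gS; rewrite /= in_itv /= te andbT (lt_trans _ t0) // oppr_lt0.
have [k hk] : exists k : 'rV[int]_2, `|y + map_mx intr k - x| < eps.
  apply: delP; rewrite yE -g0 distrC; apply: t4P => /=.
  by rewrite sub0r normrN gtr0_norm.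
pose h := y + map_mx intr k - x; rewrite -/h in hk.
have fh : f (x + h) = gamma t by rewrite /h addrC subrK torus_periodic.
move: hk; rewrite !lt_min => /and3P[h1 h2' h3].
have := d1P _ h1; have := d2P _ h2'; have := d3P _ h3.
rewrite !Dz !EP fn subr0 fh.
have := t1P t; have := t2P t; have := t3P t; rewrite t0 tt1 tt2 tt3 => /(_ isT) + /(_ isT) + /(_ isT).
rewrite gw g0 !dotvDl !dotvNl.
move=> p3 p2 p1 q3 q2 q1.
(* The displacement is controlled by its own first order image, hence by time. *)
have hA : `|h| <= A * t + 1 / 2 * `|h|.
  apply: rV_norm_le; first by rewrite addr_ge0 // mulr_ge0 // ltW.
  move=> i.
  have b (a c p : R) : `|a - t * c| <= 1 * t -> `|a - p| <= 1 / 2 * `|h| ->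
      `|c| + 1 <= A -> `|p| <= A * t + 1 / 2 * `|h|.
    move=> k1 k2 k3; have -> : p = (a - t * c) - (a - p) + t * c by ring.
    apply: le_trans (ler_normD _ _) _; apply: le_trans (lerD (ler_normB _ _) (lexx _)) _.
    rewrite normrM gtr0_norm //.
    have : (`|c| + 1) * t <= A * t by rewrite ler_wpM2r // ltW.
    move: k1 k2; lra.
  case: i => -[|[|//]] i2.
  - have -> : Ordinal i2 = 0 by exact/val_inj.
    by apply: b p1 q1 _; rewrite /A; have := normr_ge0 (dotv w (E 1)); lra.
  - have -> : Ordinal i2 = 1 by exact/val_inj.
    by apply: b p2 q2 _; rewrite /A; have := normr_ge0 (dotv w (E 0)); lra.
have hA2 : `|h| <= 2 * A * t by move: hA; lra.
have : t * `|dotv w n| <= (2 * A + 1) * eta * t.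
  have -> : t * `|dotv w n| = `|t * dotv w n| by rewrite normrM gtr0_norm.
  set a := dotv (gamma t) n - dotv (f x) n in p3 q3.
  have -> : t * dotv w n = a - (a - t * dotv w n) by ring.
  apply: le_trans (ler_normB _ _) _.
  have : eta * `|h| <= eta * (2 * A * t) by rewrite ler_wpM2l // ltW.
  move: p3 q3; lra.
by rewrite mulrC ler_pM2r.
Qed.

Lemma normal_bundleP x (n : 'rV[R]_4) :
  dotv (f x) n = 0 -> (forall h, dotv ('D_h f x) n = 0) ->
  normal_bundle (range f) (f x, n).
Proof.
move=> fn Dn; split => //=; first by exists x.
by move=> w; exact: tangent_vector_orth.
Qed.

End TorusNormals.

(** * First and second fundamental forms *)

Section NonnegForms.
Context {R : realFieldType}.

(** A nonnegative binary quadratic form has nonnegative determinant: evaluate it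
    at (B, - A), or, when A vanishes, where the cross term would win. *)
Lemma nonneg_form_det (A B C : R) :
  (forall a b, 0 <= a ^+ 2 * A + 2 * a * b * B + b ^+ 2 * C) -> 0 <= A * C - B ^+ 2.
Proof.
move=> h; have := h 1 0; rewrite !expr2 !(mulr0, mul0r, mulr1, mul1r, addr0).
rewrite le_eqVlt => /predU1P[A0|A0].
  have [B0|B0] := eqVneq B 0; first by rewrite -A0 B0; lra.
  have := h (- (C + 1) / (2 * B)) 1; rewrite -A0.
  suff -> : (- (C + 1) / (2 * B)) ^+ 2 * 0 + 2 * (- (C + 1) / (2 * B)) * 1 * B + 1 ^+ 2 * C = -1 by lra.
  by field.
have := h B (- A).
have -> : B ^+ 2 * A + 2 * B * - A * B + (- A) ^+ 2 * C = A * (A * C - B * B) by ring.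
by rewrite pmulr_rge0.
Qed.

(** If the first form (E, F, G), scaled by [c], dominates the second form
    (L, M, N), scaled by [s], in absolute value, then the sum and the difference
    have nonnegative determinants; the sum and the difference of these determinants
    are twice the first expression below and twice the last one. *)
Lemma dominated_form (E F G L M N c s : R) :
  (forall a b, `|s * (a ^+ 2 * L + 2 * a * b * M + b ^+ 2 * N)|
    <= c * (a ^+ 2 * E + 2 * a * b * F + b ^+ 2 * G)) ->
  0 <= c ^+ 2 * (E * G - F ^+ 2) + s ^+ 2 * (L * N - M ^+ 2) /\
  (c ^+ 2 * (E * G - F ^+ 2) + s ^+ 2 * (L * N - M ^+ 2) = 0 ->
   c * s * (E * N - 2 * F * M + G * L) = 0).
Proof.
move=> dom.
have dp : 0 <= (c * E + s * L) * (c * G + s * N) - (c * F + s * M) ^+ 2.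
  apply: nonneg_form_det => a b; have := dom a b; rewrite ler_norml => /andP[+ _].
  by rewrite -subr_ge0; congr (_ <= _); ring.
have dm : 0 <= (c * E - s * L) * (c * G - s * N) - (c * F - s * M) ^+ 2.
  apply: nonneg_form_det => a b; have := dom a b; rewrite ler_norml => /andP[_].
  by rewrite -subr_ge0; congr (_ <= _); ring.
set X := _ - _ in dp; set Y := _ - _ in dm.
have XY : X + Y = 2 * (c ^+ 2 * (E * G - F ^+ 2) + s ^+ 2 * (L * N - M ^+ 2)).
  by rewrite /X /Y; ring.
have XmY : X - Y = 2 * (c * s * (E * N - 2 * F * M + G * L)) by rewrite /X /Y; ring.
split; first by lra.
by move=> K0; rewrite K0 in XY; lra.
Qed.

End NonnegForms.

Section FramedForms.
Context {R : realType} {V : normedModType R} {u v : V} (S : framed_surface u v).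
Local Notation f := (fr_f S).
Local Notation nu := (fr_nu S).

Lemma second_derivative_form x (a b : R) (z : 'rV[R]_4) :
  let w := a *: u + b *: v in
  dotv ('D_w ('D_w f) x) z = a ^+ 2 * dotv ('D_u ('D_u f) x) z
    + 2 * a * b * dotv ('D_v ('D_u f) x) z + b ^+ 2 * dotv ('D_v ('D_v f) x) z.
Proof.
move=> w.
have dD w' y : differentiable ('D_w' f) y.
  exact: smooth_differentiable (smooth_derive w' (fr_sf S)).
have -> : 'D_w f = a \*: 'D_u f + b \*: 'D_v f.
  by apply/funext => y; rewrite derive_linear //; exact: smooth_differentiable (fr_sf S).
have D w' : 'D_w' (a \*: 'D_u f + b \*: 'D_v f) x = a *: 'D_w' ('D_u f) x + b *: 'D_w' ('D_v f) x.
  have dv w1 : derivable ('D_w1 f) x w' by exact: diff_derivable.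
  have dZ k w1 : derivable (k \*: 'D_w1 f) x w' by exact: derivableZ.
  have Z k w1 : 'D_w' (k \*: 'D_w1 f) x = k *: 'D_w' ('D_w1 f) x by exact: deriveZ.
  exact: etrans (deriveD (dZ a u) (dZ b v)) (congr2 +%R (Z a u) (Z b v)).
have dd : differentiable (a \*: 'D_u f + b \*: 'D_v f) x.
  by apply: differentiableD; apply: differentiableZ; exact: dD.
rewrite derive_linear // (D u) (D v).
have c := derive_comm_row u v x (fr_sf S).
have fin (Du Dv Dvu Duv : 'rV[R]_4) : Duv = Dvu ->
  dotv (a *: (a *: Du + b *: Duv) + b *: (a *: Dvu + b *: Dv)) z =
  a ^+ 2 * dotv Du z + 2 * a * b * dotv Dvu z + b ^+ 2 * dotv Dv z.
  by move=> ->; rewrite !(dotvDl, dotvZl); ring.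
exact: fin c.
Qed.

Definition formE x := dotv ('D_u f x) ('D_u f x).
Definition formF x := dotv ('D_u f x) ('D_v f x).
Definition formG x := dotv ('D_v f x) ('D_v f x).
Definition formL x := dotv ('D_u ('D_u f) x) (nu x).
Definition formM x := dotv ('D_v ('D_u f) x) (nu x).
Definition formN x := dotv ('D_v ('D_v f) x) (nu x).

Lemma form_values x :
  [/\ formE x = fr_a11 S x ^+ 2, formF x = fr_a11 S x * fr_a21 S x &
      formG x = fr_a21 S x ^+ 2 + fr_a22 S x ^+ 2] /\
  [/\ formL x = - (fr_a11 S x * dnu11 S x), formM x = - (fr_a11 S x * dnu21 S x) &
      formN x = - (fr_a21 S x * dnu21 S x + fr_a22 S x * dnu22 S x)].
Proof.
have [hE hF hG] := first_form S x; have [hL hM _ hN] := second_form S x.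
by split; [exact: And3 hE hF hG|exact: And3 hL hM hN].
Qed.

Lemma form_det1 x : formE x * formG x - formF x ^+ 2 = (fr_a11 S x * fr_a22 S x) ^+ 2.
Proof. by have [[-> -> ->] _] := form_values x; ring. Qed.

(** As the determinant of the first form is the squared area element, the quotient
    of the two determinants is that of the shape operator. *)
Lemma form_det2 x : formL x * formN x - formM x ^+ 2 =
  fr_a11 S x * fr_a22 S x * (dnu11 S x * dnu22 S x - dnu12 S x * dnu21 S x).
Proof.
have [_ [-> -> ->]] := form_values x; have := shape_sym S x.
move: (fr_a11 S x) (fr_a21 S x) (fr_a22 S x) (dnu11 S x) (dnu12 S x) (dnu21 S x) (dnu22 S x).
move=> a c d p q r t h.
transitivity (a * p * (c * r + d * t) - (a * r) * (a * r)); first ring.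
by rewrite {2}h; ring.
Qed.

(** The mixed determinant is a multiple of the mean curvature. *)
Lemma form_mixed x :
  formE x * formN x - 2 * formF x * formM x + formG x * formL x =
  - (fr_a11 S x * fr_a22 S x *
     (fr_a22 S x * dnu11 S x + fr_a11 S x * dnu22 S x - fr_a21 S x * dnu12 S x)).
Proof.
have [[-> -> ->] [-> -> ->]] := form_values x; have := shape_sym S x.
move: (fr_a11 S x) (fr_a21 S x) (fr_a22 S x) (dnu11 S x) (dnu12 S x) (dnu21 S x) (dnu22 S x).
move=> a c d p q r t h.
transitivity (a * c * (a * r) - a ^+ 2 * d * t - (c ^+ 2 + d ^+ 2) * (a * p)).
  ring.
by rewrite h; ring.
Qed.

End FramedForms.

(** * Balls tangent to the torus *)

Section FocalBounds.
Context {R : realType} (f : 'rV[R]_2 -> 'rV[R]_4) (hf : torus_embedding f).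
Local Notation S := (torus_frame hf).

Lemma S3_exp_scale (p n : 'rV[R]_4) (s : R) : dotv n n = 1 -> 0 <= s ->
  enorm (s *: n) = s /\ S3_exp (p, s *: n) = cos s *: p + sin s *: n.
Proof.
move=> n1 s0.
have es : enorm (s *: n) = s.
  by rewrite /enorm dotvZl dotvZr n1 mulr1 -expr2 sqrtr_sqr ger0_norm.
split=> //; rewrite /S3_exp /= es scalerA; congr (_ + _).
have [->|s1] := eqVneq s 0; first by rewrite sin0 mulr0.
by rewrite divfK.
Qed.

Lemma torus_normal_orth x (n : 'rV[R]_4) : dotv ('D_coord_u f x) n = 0 ->
  dotv ('D_coord_v f x) n = 0 -> forall h, dotv ('D_h f x) n = 0.
Proof.
move=> un vn h; have [a [b ->]] := coord_span h.
rewrite derive_linear; last exact: smooth_differentiable (torus_smooth hf).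
have lin0 (X Y : 'rV[R]_4) : dotv X n = 0 -> dotv Y n = 0 ->
    dotv (a *: X + b *: Y) n = 0.
  by move=> X0 Y0; rewrite dotvDl !dotvZl X0 Y0 !mulr0 addr0.
exact: lin0.
Qed.

(** The open ball of radius [s] tangent to the torus at [f x] contains no point
    of the torus as long as the exponential map is injective on a larger disc
    bundle: otherwise the centre of the ball would be reached by the exponential
    map twice, from [f x] at distance [s] and from its nearest point on the torus
    at smaller distance. *)
Lemma empty_tangent_ball r s x (n : 'rV[R]_4) :
  diffeo_onto_image (normal_disc_bundle (range f) r) S3_exp ->
  0 < s < r -> s < pi / 2 -> dotv n n = 1 -> dotv (f x) n = 0 ->
  (forall h, dotv ('D_h f x) n = 0) ->
  forall y, dotv (f y) (cos s *: f x + sin s *: n) <= cos s.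
Proof.
move=> [_ [g [gK _]]] /andP[s0 sr] s2 n1 fn Dn.
have f1 := torus_unit hf.
have [c cE] : exists c, c = cos s *: f x + sin s *: n by eexists.
rewrite -cE; have c1 : dotv c c = 1.
  by rewrite cE !dotvLE (dotvC n) fn n1 f1 -[RHS](cos2Dsin2 s); ring.
have spi : s \in `[0, pi] by rewrite in_itv /= (ltW s0) /=; have := pi_gt0 R; lra.
have [y0 y0P] := torus_max hf c.
suff : dotv (f y0) c <= cos s by move=> h y; exact: le_trans (y0P y) h.
rewrite leNgt; apply/negP => ms; set m := dotv (f y0) c in ms.
have m1 := dotv_unit_le1 (f1 y0) c1; rewrite -/m in m1.
pose s' := acos m.
have m1' : m \in `[-1, 1] by rewrite in_itv.
have cs' : cos s' = m by exact: acosK.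
have s'0 : 0 <= s' by exact: acos_ge0.
have s'pi : s' \in `[0, pi] by rewrite in_itv /= s'0 acos_lepi.
have s's : s' < s by rewrite -(ltr_cos s'pi spi) cs'.
have inA z t (k : 'rV[R]_4) : 0 <= t < r -> dotv k k = 1 -> dotv (f z) k = 0 ->
    (forall h, dotv ('D_h f z) k = 0) ->
    normal_disc_bundle (range f) r (f z, t *: k).
  move=> /andP[t0 tr] k1 fk Dk; split; last by have [-> _] := S3_exp_scale (f z) k1 t0.
  apply: (normal_bundleP hf); first by rewrite dotvZr fk mulr0.
  by move=> h; rewrite dotvZr Dk mulr0.
have Ax : normal_disc_bundle (range f) r (f x, s *: n) by apply: inA; rewrite ?(ltW s0).
have ex : S3_exp (f x, s *: n) = c.
  by rewrite cE; have [_ ->] := S3_exp_scale (f x) n1 (ltW s0).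
have Dc h : dotv ('D_h f y0) c = 0.
  by have [] := max_along_lines (torus_smooth hf) y0P h.
have uniq k : dotv k k = 1 -> dotv (f y0) k = 0 ->
    (forall h, dotv ('D_h f y0) k = 0) -> c = m *: f y0 + sin s' *: k -> False.
  move=> k1 fk Dk ck.
  have Ay : normal_disc_bundle (range f) r (f y0, s' *: k).
    by apply: inA => //; rewrite s'0 (lt_trans s's).
  have [ek ey] := S3_exp_scale (f y0) k1 s'0.
  have eq2 : (f y0, s' *: k) = (f x, s *: n).
    by rewrite -(gK _ Ay) -(gK _ Ax) ex ey cs' -ck.
  have := congr1 (fun p => enorm p.2) eq2; rewrite /= ek.
  have [-> _] := S3_exp_scale (f x) n1 (ltW s0).
  by move=> ss; rewrite ss ltxx in s's.
(* If the centre lies on the torus, any unit normal exhibits it at distance 0. *)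
have [me1|m1n] := eqVneq m 1.
  have cy : f y0 = c by apply: dotv_unit_eq.
  have [fu fe1 fe2 nu1] := frame_units S y0.
  have [[_ _ fnu] [_ e1n e2n]] := frame_orth S y0.
  apply: (uniq _ nu1 fnu).
    apply: torus_normal_orth.
      by have := nu_Duf S y0; rewrite dotvC.
    by have := nu_Dvf S y0; rewrite dotvC.
  have -> : s' = 0 by rewrite /s' me1 -[RHS](cosK (x := 0)) ?cos0 // in_itv /= lexx pi_ge0.
  by rewrite sin0 scale0r addr0 me1 scale1r.
have sin0' : 0 < sin s'.
  apply: sin_gt0_pi; rewrite lt_neqAle s'0 andbT; apply/andP; split.
    apply: contra_neq m1n => s'00; by rewrite -cs' -s'00 cos0.
  by apply: lt_le_trans s's _; move: spi; rewrite in_itv => /andP[].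
pose k := (sin s')^-1 *: (c - m *: f y0).
have kk : dotv k k = 1.
  rewrite /k !dotvLE c1 f1 (dotvC c) -/m.
  transitivity ((sin s') ^- 2 * (1 - m ^+ 2)); first by rewrite expr2 invfM; ring.
  have -> : 1 - m ^+ 2 = sin s' ^+ 2 by rewrite -cs' -(cos2Dsin2 s'); ring.
  by rewrite mulVf // sqrf_eq0 gt_eqF.
apply: (uniq k kk).
- by rewrite /k !dotvLE f1 -/m; ring.
- move=> h; rewrite /k !dotvLE Dc dotvC.
  have -> : dotv (f y0) ('D_h f y0) = 0.
    by rewrite dotvC; exact: dotv_derive_unit (torus_smooth hf) f1 y0 h.
  by ring.
- by rewrite /k scalerA divff ?gt_eqF // scale1r addrC subrK.
Qed.

(** Second order expansion, at the point of tangency, of the emptiness of the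
    tangent balls on either side. *)
Lemma curvature_bound r s x :
  diffeo_onto_image (normal_disc_bundle (range f) r) S3_exp ->
  0 < s < r -> s < pi / 2 -> forall w,
  `|sin s * dotv ('D_w ('D_w f) x) (fr_nu S x)| <=
    cos s * dotv ('D_w f x) ('D_w f x).
Proof.
move=> adm sr s2 w.
have f1 := torus_unit hf; have sf := torus_smooth hf.
have key n : dotv n n = 1 -> dotv (f x) n = 0 ->
    (forall h, dotv ('D_h f x) n = 0) ->
    sin s * dotv ('D_w ('D_w f) x) n <= cos s * dotv ('D_w f x) ('D_w f x).
  move=> n1 fn Dn.
  have ball := empty_tangent_ball adm sr s2 n1 fn Dn.
  have mx y : dotv (f y) (cos s *: f x + sin s *: n)
      <= dotv (f x) (cos s *: f x + sin s *: n).
    by apply: le_trans (ball y) _; rewrite !dotvLE f1 fn mulr1 mulr0 addr0.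
  have [_] := max_along_lines sf mx w.
  have Df y : dotv ('D_w f y) (f y) = 0 by exact: dotv_derive_unit sf f1 y w.
  have Dff := dotv_derive_cst (smooth_derive w sf) sf Df x w.
  by rewrite dotvDr !dotvZr Dff mulrN addrC subr_le0.
have [_ _ _ nu1] := frame_units S x.
have [[_ _ fnu] _] := frame_orth S x.
have Dnu h : dotv ('D_h f x) (fr_nu S x) = 0.
  apply: torus_normal_orth.
    by have := nu_Duf S x; rewrite dotvC.
  by have := nu_Dvf S x; rewrite dotvC.
rewrite ler_norml key // andbT lerNl -mulrN -dotvNr; apply: key.
- by rewrite dotvNl dotvNr opprK.
- by rewrite dotvNr fnu oppr0.
- by move=> h; rewrite dotvNr Dnu oppr0.
Qed.

End FocalBounds.

(** * Curvature of a torus of large focal radius *)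

Section FocalCurvature.
Context {R : realType}.

(** Written in the frame, the combination of determinants is the squared area
    element times c^2 + s^2 det, where det is the determinant of the shape
    operator; for c = s it is a multiple of the Gauss curvature. *)
Lemma dominated_surface {V : normedModType R} {u v : V} (S : framed_surface u v)
    (c s : R) x :
  (forall w, `|s * dotv ('D_w ('D_w (fr_f S)) x) (fr_nu S x)| <=
    c * dotv ('D_w (fr_f S) x) ('D_w (fr_f S) x)) ->
  let area := fr_a11 S x * fr_a22 S x in
  let det := dnu11 S x * dnu22 S x - dnu12 S x * dnu21 S x in
  0 <= c ^+ 2 * area ^+ 2 + s ^+ 2 * (area * det) /\
  (c ^+ 2 * area ^+ 2 + s ^+ 2 * (area * det) = 0 ->
   c * s * (fr_a22 S x * dnu11 S x + fr_a11 S x * dnu22 S x - fr_a21 S x * dnu12 S x) = 0).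
Proof.
move=> dom area det.
have form1 a b : dotv ('D_(a *: u + b *: v) (fr_f S) x) ('D_(a *: u + b *: v) (fr_f S) x)
    = a ^+ 2 * formE S x + 2 * a * b * formF S x + b ^+ 2 * formG S x.
  rewrite derive_linear; last exact: smooth_differentiable (fr_sf S).
  have fin (X Y : 'rV[R]_4) : dotv (a *: X + b *: Y) (a *: X + b *: Y) =
     a ^+ 2 * dotv X X + 2 * a * b * dotv X Y + b ^+ 2 * dotv Y Y.
    by rewrite !dotvLE (dotvC Y X); ring.
  exact: fin.
have dom2 a b : `|s * (a ^+ 2 * formL S x + 2 * a * b * formM S x + b ^+ 2 * formN S x)|
    <= c * (a ^+ 2 * formE S x + 2 * a * b * formF S x + b ^+ 2 * formG S x).
  rewrite -form1; have := dom (a *: u + b *: v).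
  by rewrite (second_derivative_form S x a b (fr_nu S x)).
have [ge0 eq0] := dominated_form dom2; move: ge0 eq0.
rewrite form_det1 form_det2 form_mixed -/area -/det => ge0 eq0; split=> // /eq0.
have ar0 : area != 0 by rewrite gt_eqF // mulr_gt0 ?fr_a11_gt0 ?fr_a22_gt0.
rewrite mulrN mulrCA -/area => /eqP; rewrite oppr_eq0 mulf_eq0 (negPf ar0) /=.
by move=> /eqP.
Qed.

Context (f : 'rV[R]_2 -> 'rV[R]_4) (hf : torus_embedding f).
Local Notation S := (torus_frame hf).

Lemma focal_radius_gt (s : R) : (s%:E < focal_radius (range f))%E ->
  exists2 r : R, s < r &
    diffeo_onto_image (normal_disc_bundle (range f) r) S3_exp.
Proof.
move=> /ereal_sup_gt[_ [r [r0 adm] <-]]; rewrite lte_fin => sr.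
by exists r.
Qed.

Lemma cos_pi4 : cos (pi / 4 : R) = sin (pi / 4).
Proof.
rewrite -cosBpihalf -[RHS]cosN; congr cos.
by field.
Qed.

(** The bound holds with cos s / sin s as a factor for all s < pi / 4, and passes
    to the limit. *)
Lemma focal_ge_curvature x w : ((pi / 4)%:E <= focal_radius (range f))%E ->
  `|dotv ('D_w ('D_w f) x) (fr_nu S x)| <= dotv ('D_w f x) ('D_w f x).
Proof.
move=> foc; set A := dotv _ _; set B := dotv _ _.
have pi0 := pi_gt0 R.
have bound t : 0 < t < pi / 4 -> sin t * `|A| <= cos t * B.
  move=> /andP[t0 t4].
  have [|r tr adm] := @focal_radius_gt t; first by apply: lt_le_trans foc; rewrite lte_fin.
  have := curvature_bound hf x adm (s := t); rewrite t0 tr => /(_ isT).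
  have t2 : t < pi / 2 by lra.
  move=> /(_ t2 w); rewrite normrM ger0_norm //.
  by apply: sin_ge0_pi; rewrite (ltW t0) /=; lra.
pose g t : R := cos t * B - sin t * `|A|.
have cg : continuous g.
  move=> t; apply: (@cvgB R R^o); apply: (@cvgM R).
  - exact: continuous_cos.
  - exact: cvg_cst.
  - exact: continuous_sin.
  - exact: cvg_cst.
have s4 : 0 < sin (pi / 4 : R) by apply: sin_gt0_pi; apply/andP; split; lra.
rewrite -(ler_pM2l s4) -{2}cos_pi4 -subr_ge0 -/(g (pi / 4)).
rewrite leNgt; apply/negP => g0.
have gl : g @ (pi / 4 : R)^'- --> g (pi / 4) by apply: cvg_at_left_filter; exact: cg.
have nn : \forall t \near (pi / 4 : R)^'-, [/\ g t < 0, t < pi / 4 & 0 < t].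
  near=> t; split.
  - near: t; exact: (cvgr_lt _ gl _ g0).
  - near: t; exact: nbhs_left_lt.
  - near: t; apply: nbhs_left_gt; lra.
have ext : exists t, [/\ g t < 0, t < pi / 4 & 0 < t] by exact: (@filter_ex _ _ (at_left_proper_filter _) _ nn).
case: ext => t [gt0 t4 t0].
have := bound t; rewrite t0 t4 => /(_ isT).
by rewrite -subr_ge0 -/(g t) leNgt gt0.
Unshelve. all: by end_near. Qed.

(** Principal curvatures of absolute value at most 1 make the Gauss curvature
    nonnegative; Gauss-Bonnet makes it vanish.  The curvature bound is then an
    equality in the principal directions, so that the mean curvature vanishes
    too. *)
Lemma focal_ge_flat_minimal : ((pi / 4)%:E <= focal_radius (range f))%E ->
  (forall x, fr_a11 S x * fr_a22 S x
     + (dnu11 S x * dnu22 S x - dnu12 S x * dnu21 S x) = 0) /\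
  (forall x, fr_a22 S x * dnu11 S x + fr_a11 S x * dnu22 S x
     - fr_a21 S x * dnu12 S x = 0).
Proof.
move=> foc.
have dom x w : `|1 * dotv ('D_w ('D_w f) x) (fr_nu S x)|
    <= 1 * dotv ('D_w f x) ('D_w f x).
  by rewrite !mul1r; exact: focal_ge_curvature.
have area0 x : 0 < fr_a11 S x * fr_a22 S x.
  by rewrite mulr_gt0 ?fr_a11_gt0 ?fr_a22_gt0.
have flat := gauss_bonnet (S := S) (torus_periodic_u hf) (torus_periodic_v hf).
have flat0 x : fr_a11 S x * fr_a22 S x + (dnu11 S x * dnu22 S x - dnu12 S x * dnu21 S x) = 0.
  apply: flat => y; have [+ _] := dominated_surface (S := S) (dom y).
  rewrite expr1n !mul1r expr2 -mulrDr pmulr_rge0 //.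
split=> // x; have [_] := dominated_surface (S := S) (dom x).
rewrite expr1n !mul1r expr2 -mulrDr flat0 mulr0; exact.
Qed.

(** A focal radius larger than pi / 4 would bound the principal curvatures by some
    number smaller than 1, and the Gauss curvature would be positive. *)
Lemma focal_le : (focal_radius (range f) <= (pi / 4)%:E)%E.
Proof.
rewrite leNgt; apply/negP => foc.
have [flat _] := focal_ge_flat_minimal (ltW foc).
have [r r4 adm] := focal_radius_gt foc.
have pi0 := pi_gt0 R.
(* The midpoint of pi / 4 and the smaller of [r] and pi / 2. *)
have [s [s4 s2 sr]] : exists s : R, [/\ pi / 4 < s, s < pi / 2 & s < r].
  exists ((pi / 4 + Num.min r (pi / 2)) / 2).
  have : pi / 4 < Num.min r (pi / 2) by rewrite lt_min r4 /=; lra.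
  have : Num.min r (pi / 2) <= r by rewrite ge_min lexx.
  have : Num.min r (pi / 2) <= pi / 2 by rewrite ge_min lexx orbT.
  by move: (Num.min _ _) => m; split; lra.
have s0 : 0 < s by apply: lt_trans s4; lra.
have bound := curvature_bound hf 0 adm (s := s); rewrite s0 sr in bound.
have [+ _] := dominated_surface (S := S) (bound isT s2).
have area0 : 0 < fr_a11 S 0 * fr_a22 S 0.
  by rewrite mulr_gt0 ?fr_a11_gt0 ?fr_a22_gt0.
have -> : dnu11 S 0 * dnu22 S 0 - dnu12 S 0 * dnu21 S 0 = - (fr_a11 S 0 * fr_a22 S 0).
  by apply/eqP; rewrite -addr_eq0 addrC flat.
move: (fr_a11 S 0 * fr_a22 S 0) area0 => a a0.
have -> : cos s ^+ 2 * a ^+ 2 + sin s ^+ 2 * (a * - a) =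
  a ^+ 2 * (cos s ^+ 2 - sin s ^+ 2) by ring.
rewrite pmulr_rge0 ?exprn_gt0 // subr_ge0 leNgt => /negP; apply.
have c0 : 0 < cos s by apply: cos_gt0_pihalf; rewrite s2 andbT; lra.
rewrite ltr_sqr ?nnegrE ?(ltW c0) //; last first.
  by apply: sin_ge0_pi; rewrite (ltW s0) /=; lra.
by rewrite -cosBpihalf -[ltRHS]cosN ltr_cos ?in_itv /=; try (apply/andP; split); lra.
Qed.

End FocalCurvature.

(** * Rigidity in the case of equality *)

Section OrthonormalCoordinates.
Context {R : realType}.
Implicit Types b : 'I_4 -> 'rV[R]_4.

Lemma dotv_suml (F : 'I_4 -> 'rV[R]_4) y :
  dotv (\sum_i F i) y = \sum_i dotv (F i) y.
Proof. exact: (big_morph (dotv^~ y) (fun p q => dotvDl p q y) (dotv0l y)). Qed.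

Definition basis_coord b (x : 'rV[R]_4) : 'rV[R]_4 := \row_i dotv x (b i).

Lemma basis_coord_dotv b x y : orthonormal4 b ->
  dotv (basis_coord b x) (basis_coord b y) = dotv x y.
Proof.
move=> ob; rewrite [in RHS](orthonormal4_sum x ob) dotv_suml.
by apply: eq_bigr => i _; rewrite !mxE dotvZl (dotvC y).
Qed.

Lemma basis_coord_surj b z : orthonormal4 b ->
  exists x, basis_coord b x = z.
Proof.
move=> ob; exists (\sum_i z 0 i *: b i); apply/rowP => j; rewrite mxE.
rewrite dotv_suml (bigD1 j) //= dotvZl ob eqxx mulr1 big1 ?addr0 // => i ij.
by rewrite dotvZl ob (negPf ij) mulr0.
Qed.

Lemma basis_coord_isometry b : orthonormal4 b -> S3_isometry (basis_coord b).
Proof.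
move=> ob; split; last by move=> p q _ _; rewrite /S3_dist basis_coord_dotv.
apply/seteqP; split=> [_ [x /S3E x1 <-]|z /S3E z1].
  by apply/S3E; rewrite basis_coord_dotv.
have [x xz] := basis_coord_surj z ob; exists x => //.
by apply/S3E; rewrite -(basis_coord_dotv x x ob) xz.
Qed.

Definition clifford_form (z : 'rV[R]_4) : R :=
  z 0 0 ^+ 2 + z 0 1 ^+ 2 - z 0 2 ^+ 2 - z 0 3 ^+ 2.

Lemma clifford_torusE z : clifford_torus z <-> dotv z z = 1 /\ clifford_form z = 0.
Proof.
have [E0 E1 E2 E3] := rcoordE z.
have s2 : (Num.sqrt 2 : R)^-1 ^+ 2 = 1 / 2 by rewrite exprVn sqr_sqrtr // mul1r.
have sq (a c : R) : Num.sqrt (a ^+ 2 + c ^+ 2) = (Num.sqrt 2)^-1 <-> a ^+ 2 + c ^+ 2 = 1 / 2.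
  have p0 : 0 <= a ^+ 2 + c ^+ 2 by rewrite addr_ge0 ?sqr_ge0.
  split=> h; first by rewrite -s2 -h sqr_sqrtr.
  by rewrite h -s2 sqrtr_sqr ger0_norm // invr_ge0 sqrtr_ge0.
rewrite /clifford_torus /= /znorm1 /znorm2 E0 E1 E2 E3 /clifford_form dotvE -!expr2.
split=> [[/sq h1 /sq h2]|[h1 h2]]; first by split; lra.
by split; apply/sq; lra.
Qed.

Lemma image_clifford b (Sigma : set 'rV[R]_4) : orthonormal4 b ->
  (forall x, Sigma x <-> dotv x x = 1 /\ clifford_form (basis_coord b x) = 0) ->
  basis_coord b @` Sigma = clifford_torus.
Proof.
move=> ob SE; apply/seteqP; split=> [_ [x /SE[x1 hx] <-]|z /clifford_torusE[z1 hz]].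
  by apply/clifford_torusE; rewrite basis_coord_dotv.
have [x xz] := basis_coord_surj z ob; exists x => //.
by apply/SE; rewrite -(basis_coord_dotv x x ob) xz.
Qed.

End OrthonormalCoordinates.

Section NearestPoint.
Context {R : realType} {V : normedModType R} {u v : V} (S : framed_surface u v).
Local Notation f := (fr_f S).

(** Where the distance from a point [q] of the quadric is critical along a flat
    surface, [q] is up to sign the position or the normal; as the surface is
    saddle-shaped, the normal is excluded where the distance is minimal. *)
Lemma flat_surface_nearest x q :
  fr_a11 S x * fr_a22 S x + (dnu11 S x * dnu22 S x - dnu12 S x * dnu21 S x) = 0 ->
  dotv q q = 1 -> dotv q (invol S x q) = 0 ->
  (forall w, dotv ('D_w f x) q = 0 /\ dotv ('D_w ('D_w f) x) q <= 0) ->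
  f x = q \/ dotv (f x) q = -1.
Proof.
move=> flat q1 qr tests.
have e1q : dotv q (fr_e1 S x) = 0.
  have [+ _] := tests u; rewrite fr_Duf dotvZl dotvC => /eqP.
  by rewrite mulf_eq0 gt_eqF ?fr_a11_gt0 //= => /eqP.
have e2q : dotv q (fr_e2 S x) = 0.
  have [+ _] := tests v; rewrite fr_Dvf dotvDl !dotvZl !(dotvC _ q) e1q mulr0 add0r => /eqP.
  by rewrite mulf_eq0 gt_eqF ?fr_a22_gt0 //= => /eqP.
have := frame_expand S x q; rewrite e1q e2q !scale0r !addr0.
have := frame_parseval S x q q; rewrite e1q e2q q1.
have : dotv q (invol S x q) = 2 * (dotv q (f x) * dotv q (fr_nu S x)).
  by rewrite /invol e1q e2q !scale0r !addr0 dotvDr !dotvZr; ring.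
rewrite qr (dotvC (f x)).
move: (dotv q (f x)) (dotv q (fr_nu S x)) => al be ab0 ab1 qE.
have : al * be = 0 by move: ab0; lra.
move=> /eqP; rewrite mulf_eq0 => /orP[/eqP a0|/eqP b0].
  exfalso; have be1 : be ^+ 2 = 1 by rewrite ab1 a0; ring.
  rewrite a0 scale0r add0r in qE.
  have neg a b : 0 <= a ^+ 2 * (- be * formL S x) + 2 * a * b * (- be * formM S x)
      + b ^+ 2 * (- be * formN S x).
    have [_ t] := tests (a *: u + b *: v).
    have Q X : dotv X q = be * dotv X (fr_nu S x) by rewrite qE dotvZr.
    have t' := eq_ind _ (fun r : R => r <= 0) t _ (second_derivative_form S x a b q).
    have fin (X Y Z : 'rV[R]_4) :
        a ^+ 2 * dotv X q + 2 * a * b * dotv Y q + b ^+ 2 * dotv Z q <= 0 ->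
        0 <= a ^+ 2 * (- be * dotv X (fr_nu S x))
          + 2 * a * b * (- be * dotv Y (fr_nu S x))
          + b ^+ 2 * (- be * dotv Z (fr_nu S x)).
      by rewrite !Q -oppr_ge0; congr (_ <= _); ring.
    exact: fin t'.
  have := nonneg_form_det neg.
  have -> : (- be * formL S x) * (- be * formN S x) - (- be * formM S x) ^+ 2 =
    be ^+ 2 * (formL S x * formN S x - formM S x ^+ 2) by ring.
  rewrite be1 mul1r form_det2.
  have -> : dnu11 S x * dnu22 S x - dnu12 S x * dnu21 S x = - (fr_a11 S x * fr_a22 S x).
    by apply/eqP; rewrite -addr_eq0 addrC flat.
  by rewrite mulrN oppr_ge0 leNgt !mulr_gt0 ?fr_a11_gt0 ?fr_a22_gt0.
rewrite b0 scale0r addr0 in qE.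
have : (al - 1) * (al + 1) = 0.
  have al2 : al * al = 1 by rewrite [RHS]ab1 b0; ring.
  by transitivity (al * al - 1); [ring|rewrite al2 subrr].
move=> /eqP; rewrite mulf_eq0 subr_eq0 addr_eq0 => /orP[]/eqP h; [left|right] => //.
by rewrite qE h scale1r.
Qed.

(** The cosine and the sine of half of the angle with cosine [al] and sine [be]. *)
Lemma half_angle (al be : R) : al ^+ 2 + be ^+ 2 = 1 ->
  exists p q : R, [/\ p ^+ 2 + q ^+ 2 = 1, p ^+ 2 - q ^+ 2 = al & 2 * (p * q) = be].
Proof.
move=> ab1.
have a1 : -1 <= al <= 1.
  rewrite -ler_norml -sqrtr_sqr -[leRHS]sqrtr1; apply: ler_wsqrtr.
  by rewrite -ab1 lerDl sqr_ge0.
pose P := Num.sqrt ((1 + al) / 2); pose Q := Num.sqrt ((1 - al) / 2).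
have P2 : P ^+ 2 = (1 + al) / 2 by rewrite sqr_sqrtr //; move: a1 => /andP[]; lra.
have Q2 : Q ^+ 2 = (1 - al) / 2 by rewrite sqr_sqrtr //; move: a1 => /andP[]; lra.
have PQ : (2 * (P * Q)) ^+ 2 = be ^+ 2.
  have -> : be ^+ 2 = 1 - al ^+ 2 by rewrite -ab1; ring.
  by rewrite !exprMn P2 Q2; field.
have := PQ => /eqP; rewrite eqf_sqr => /orP[]/eqP h.
  by exists P, Q; rewrite h P2 Q2; split=> //; field.
by exists P, (- Q); rewrite sqrrN P2 Q2 mulrN mulrN h opprK; split=> //; field.
Qed.

(** Position plus and minus normal are eigenvectors of the involution; on the
    tangent plane, where it is a reflection, halving its angle gives the axes. *)
Lemma invol_basis x : shape1 S x ^+ 2 + shape2 S x ^+ 2 = 1 ->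
  exists b, orthonormal4 b /\
  forall y, dotv y (invol S x y) = clifford_form (basis_coord b y).
Proof.
move=> sh.
have [p [q [pq1 pqa pqb]]] := half_angle sh.
pose c : R := (Num.sqrt 2)^-1.
have c2 : c * c = 1 / 2 by rewrite -expr2 exprVn sqr_sqrtr // mul1r.
pose b0 := c *: (f x + fr_nu S x); pose b1 := p *: fr_e1 S x + q *: fr_e2 S x.
pose b2 := c *: (f x - fr_nu S x); pose b3 := p *: fr_e2 S x - q *: fr_e1 S x.
exists (family4 b0 b1 b2 b3); split.
  have d01 : dotv b0 b1 = 0 by rewrite /b0 /b1 !dotvLE !(frame_dot S); ring.
  have d02 : dotv b0 b2 = 0 by rewrite /b0 /b2 !dotvLE !(frame_dot S); ring.
  have d03 : dotv b0 b3 = 0 by rewrite /b0 /b3 !dotvLE !(frame_dot S); ring.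
  have d12 : dotv b1 b2 = 0 by rewrite /b1 /b2 !dotvLE !(frame_dot S); ring.
  have d13 : dotv b1 b3 = 0 by rewrite /b1 /b3 !dotvLE !(frame_dot S); ring.
  have d23 : dotv b2 b3 = 0 by rewrite /b2 /b3 !dotvLE !(frame_dot S); ring.
  have d00 : dotv b0 b0 = 1.
    rewrite /b0 !dotvLE !(frame_dot S); transitivity (2 * (c * c)); first ring.
    by rewrite c2; field.
  have d22 : dotv b2 b2 = 1.
    rewrite /b2 !dotvLE !(frame_dot S); transitivity (2 * (c * c)); first ring.
    by rewrite c2; field.
  have d11 : dotv b1 b1 = 1.
    by rewrite -[RHS]pq1 /b1 !dotvLE !(frame_dot S); ring.
  have d33 : dotv b3 b3 = 1.
    by rewrite -[RHS]pq1 /b3 !dotvLE !(frame_dot S); ring.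
  move: b0 b1 b2 b3 d01 d02 d03 d12 d13 d23 d00 d11 d22 d33.
  move=> b0 b1 b2 b3 d01 d02 d03 d12 d13 d23 d00 d11 d22 d33.
  by move=> [[|[|[|[|//]]]] i4] [[|[|[|[|//]]]] j4]; rewrite /family4 /= // dotvC.
move=> y; rewrite /invol /clifford_form !mxE /family4 /= /b0 /b1 /b2 /b3 !dotvLE.
rewrite -pqa -pqb; move: (dotv y _) (dotv y _) (dotv y _) (dotv y _) => w z t s.
transitivity (2 * (s * t) + (p ^+ 2 - q ^+ 2) * (z ^+ 2 - w ^+ 2) + 4 * (p * q * z * w)).
  ring.
transitivity (4 * (c * c) * (s * t) + (p ^+ 2 - q ^+ 2) * (z ^+ 2 - w ^+ 2) + 4 * (p * q * z * w)).
  by rewrite c2; field.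
ring.
Qed.

End NearestPoint.

Section Rigidity.
Context {R : realType} (f : 'rV[R]_2 -> 'rV[R]_4) (hf : torus_embedding f).
Local Notation S := (torus_frame hf).
Context (foc : ((pi / 4)%:E <= focal_radius (range f))%E).

Let flat := (focal_ge_flat_minimal hf foc).1.
Let minimal := (focal_ge_flat_minimal hf foc).2.

Definition reflection (y : 'rV[R]_4) : 'rV[R]_4 := invol S 0 y.

Lemma reflectionE x y : reflection y = invol S x y.
Proof. exact: (invol_constant coord_span flat minimal). Qed.

Lemma torus_sub_quadric x : dotv (f x) (reflection (f x)) = 0.
Proof.
rewrite (reflectionE x); have [[_ _ h] _] := frame_orth S x.
exact: etrans (congr1 _ (invol_f S x)) h.
Qed.

(** The point of the torus nearest to [q] is [q] or its opposite; in the latter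
    case, the whole torus would be reduced to the opposite point. *)
Lemma quadric_sub_torus q : dotv q q = 1 -> dotv q (reflection q) = 0 ->
  range f q.
Proof.
move=> q1 qr; have [x xP] := torus_max hf q.
rewrite (reflectionE x) in qr.
have [fq|am1] := flat_surface_nearest (flat x) q1 qr
  (max_along_lines (torus_smooth hf) xP); first by exists x.
exfalso.
have fq y : f y = - q.
  apply: dotv_unit_eq; rewrite ?dotvNl ?dotvNr ?opprK ?q1 ?torus_unit //.
  have := xP y; have := dotv_unit_le1 (torus_unit hf y) q1.
  by move: am1; rewrite /= => -> /andP[]; lra.
have Du0 : 'D_coord_u f 0 = 0.
  have -> : f = (fun=> - q) by apply/funext => y; exact: fq.
  exact: derive_cst.
have [|/eqP] := torus_immersion hf (x := 0) (a := 1) (b := 0); last by rewrite oner_eq0.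
by rewrite Du0 scaler0 scale0r addr0.
Qed.

Lemma torus_clifford : exists phi : 'rV[R]_4 -> 'rV[R]_4,
  S3_isometry phi /\ phi @` range f = clifford_torus.
Proof.
have [b [ob bE]] := invol_basis (shape_unit flat minimal 0).
exists (basis_coord b); split; first exact: basis_coord_isometry.
apply: image_clifford => // x; split=> [[y _ <-]|[x1 x0]].
  by split; [exact: torus_unit|rewrite -bE; exact: torus_sub_quadric].
by apply: quadric_sub_torus => //; rewrite /reflection bE.
Qed.

End Rigidity.

(** * Normals of the Clifford torus *)

Section CircleCurves.
Context {R : realType}.
Implicit Types (a w c p v : 'rV[R]_4) (Sigma : set 'rV[R]_4).

Lemma circle_tangent Sigma a w c :
  (forall t : R, Sigma (cos t *: a + sin t *: w + c)) ->
  tangent_vector Sigma (a + c) w.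
Proof.
move=> inS; pose g (t : R) := cos t *: a + sin t *: w + c.
have sT k : Ck_on k [set: R] g.
  have [Cc Cs] := Ck_on_cos_sin (R := R) k openT.
  apply: (Ck_onD openT); last exact: Ck_on_cst.
  by apply: (Ck_onD openT); exact: (Ck_onZl _ openT).
exists 1, g; split=> //.
- by move=> k; apply: Ck_on_sub (sT k) => x _.
- by move=> t _; exact: inS.
- by rewrite /g cos0 sin0 scale1r scale0r addr0.
rewrite derive1E; apply/rowP => i.
have dg : differentiable g 0 by have [+ _] := sT 1%N; exact.
rewrite -derive_coord // /g.
have D : is_derive (0 : R) 1 (fun t : R => cos t * a 0 i + sin t * w 0 i + c 0 i)
    (- sin 0 * a 0 i + cos 0 * w 0 i + 0).
  have D1 := is_deriveM (is_derive_cos (0 : R)) (is_derive_cst (a 0 i) (0 : R) 1).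
  have D2 := is_deriveM (is_derive_sin (0 : R)) (is_derive_cst (w 0 i) (0 : R) 1).
  have D3 := is_deriveD (is_deriveD D1 D2) (is_derive_cst (c 0 i) (0 : R) 1).
  by apply: is_derive_eq D3 _; rewrite !scaler0 !add0r /GRing.scale /= !(mulrC (_ 0 i)).
have E : - sin 0 * a 0 i + cos 0 * w 0 i + 0 = w 0 i.
  by rewrite sin0 cos0 oppr0 mul0r mul1r add0r addr0.
rewrite -E; have [_ <-] := D.
apply: (congr1 (fun h : R -> R => 'D_(1 : R) h (0 : R))).
by apply/funext => t; rewrite !mxE.
Qed.

(** If the component of [v] in the range of [P] were not proportional to [P p],
    its part orthogonal to [P p] would be, up to scaling, the velocity of a
    rotation of [P p] inside that range. *)
Lemma rotation_normal (P : 'rV[R]_4 -> 'rV[R]_4) Sigma p v :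
  (forall x y, dotv (P x) y = dotv x (P y)) -> (forall x, P (P x) = P x) ->
  (forall s x y, P (s *: x + y) = s *: P x + P y) ->
  dotv (P p) (P p) = 1 / 2 ->
  (forall w, P w = w -> dotv w (P p) = 0 -> dotv w w = 1 / 2 ->
     forall t : R, Sigma (cos t *: P p + sin t *: w + (p - P p))) ->
  (forall w, tangent_vector Sigma p w -> dotv w v = 0) ->
  P v = (2 * dotv v (P p)) *: P p.
Proof.
move=> sym idem lin pp inS nv.
pose w := - (2 * dotv v (P p)) *: P p + P v.
have Pw : P w = w by rewrite /w lin !idem.
have wp : dotv w (P p) = 0.
  by rewrite /w dotvDl dotvZl pp sym idem; field.
suff : w = 0 by move=> /eqP; rewrite /w addrC scaleNr subr_eq0 => /eqP.
apply: contrapT => /eqP w0; have ww := dotv_gt0 w0.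
pose k := (Num.sqrt (2 * dotv w w))^-1.
have k0 : 0 < k by rewrite invr_gt0 sqrtr_gt0 mulr_gt0.
have k2 : k * k * dotv w w = 1 / 2.
  rewrite -expr2 exprVn sqr_sqrtr; last by rewrite mulr_ge0 // ltW.
  by field; rewrite gt_eqF.
have tv : tangent_vector Sigma p (k *: w).
  have -> : p = P p + (p - P p) by rewrite addrC subrK.
  apply: circle_tangent; apply: inS.
  - have P0 : P 0 = 0 by have := lin (-1) 0 0; rewrite scaler0 addr0 scaleN1r addNr.
    by rewrite -[k *: w]addr0 lin P0 Pw.
  - by rewrite dotvZl wp mulr0.
  - by rewrite dotvZl dotvZr mulrA.
have := nv _ tv; rewrite dotvZl => /eqP; rewrite mulf_eq0 gt_eqF //= => /eqP wv.
have : dotv w w = 0.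
  rewrite {2}/w dotvDr dotvZr wp mulr0 add0r -sym Pw; exact: wv.
by move=> h; rewrite h ltxx in ww.
Qed.

End CircleCurves.

Section QuadricNormalMap.
Context {R : realType} (P : 'rV[R]_4 -> 'rV[R]_4).
Context (Psym : forall x y, dotv (P x) y = dotv x (P y)).
Context (Pidem : forall x, P (P x) = P x).
Context (Plin : forall s x y, P (s *: x + y) = s *: P x + P y).
Context (Psmooth : forall (V : normedModType R) (U : set V) k (g : V -> 'rV[R]_4),
  open U -> Ck_on k U g -> Ck_on k U (fun x => P (g x))).

(** With [P] an orthogonal projection onto a plane, this is a Clifford torus. *)
Definition equidistant : set 'rV[R]_4 :=
  [set x | dotv x x = 1 /\ dotv (P x) (P x) = 1 / 2].

Definition coproj y := locked (y - P y).

Lemma coprojE y : coproj y = y - P y.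
Proof. by rewrite /coproj -lock. Qed.

Lemma P_zero : P 0 = 0.
Proof. by have := Plin (-1) 0 0; rewrite scaler0 addr0 scaleN1r addNr. Qed.

Lemma P_add x y : P (x + y) = P x + P y.
Proof. by rewrite -{1}(scale1r x) Plin scale1r. Qed.

Lemma P_scale s x : P (s *: x) = s *: P x.
Proof. by rewrite -[s *: x]addr0 Plin P_zero addr0. Qed.

Lemma coproj_sym x y : dotv (coproj x) y = dotv x (coproj y).
Proof. by rewrite !coprojE !dotvLE Psym. Qed.

Lemma P_coproj x : P (coproj x) = 0.
Proof. by rewrite coprojE -scaleN1r addrC Plin Pidem scaleN1r addNr. Qed.

Lemma coproj_idem x : coproj (coproj x) = coproj x.
Proof. by rewrite [LHS]coprojE P_coproj subr0. Qed.

Lemma coproj_linear s x y : coproj (s *: x + y) = s *: coproj x + coproj y.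
Proof. by rewrite !coprojE Plin scalerBr opprD addrACA. Qed.

Lemma dotv_P_coproj x y : dotv (P x) (coproj y) = 0.
Proof. by rewrite Psym P_coproj dotv0r. Qed.

Lemma P_decomp x : x = P x + coproj x.
Proof. by rewrite coprojE addrC subrK. Qed.

Lemma equidistantP x : equidistant x <->
  dotv (P x) (P x) = 1 / 2 /\ dotv (coproj x) (coproj x) = 1 / 2.
Proof.
have xx : dotv x x = dotv (P x) (P x) + dotv (coproj x) (coproj x).
  rewrite {1 2}(P_decomp x) dotvDl !dotvDr dotv_P_coproj.
  by rewrite (dotvC (coproj x) (P x)) dotv_P_coproj addr0 add0r.
rewrite /equidistant /= xx; split=> [[h1 h2]|[h1 h2]]; split=> //; first lra.
by rewrite h1 h2; field.
Qed.

(** In the tangent space of the sphere at [p], orthogonality to the rotations in the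
    range of [P] and in its kernel leaves the multiples of one unit vector. *)
Lemma equidistant_normal p v : normal_bundle equidistant (p, v) ->
  exists s : R, v = s *: (P p - coproj p).
Proof.
move=> [/= Sp pv nv]; have [pp cc] := (equidistantP p).1 Sp.
have Pv : P v = (2 * dotv v (P p)) *: P p.
  apply: (rotation_normal (Sigma := equidistant)) => // w Pw wp ww t.
  have -> : p - P p = coproj p by rewrite coprojE.
  have PP : P (cos t *: P p + sin t *: w + coproj p) = cos t *: P p + sin t *: w.
    by rewrite P_add P_coproj addr0 Plin Pidem P_scale Pw.
  apply/equidistantP; split.
    rewrite PP !dotvLE pp ww wp (dotvC (P p)) wp.
    by transitivity ((cos t ^+ 2 + sin t ^+ 2) / 2); [field|rewrite cos2Dsin2].
  by rewrite coprojE PP addrAC subrr add0r.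
have Cv : coproj v = (2 * dotv v (coproj p)) *: coproj p.
  apply: (rotation_normal (P := coproj) (Sigma := equidistant)).
  - exact: coproj_sym.
  - exact: coproj_idem.
  - exact: coproj_linear.
  - exact: cc.
  - move=> w Cw wp ww t.
    have Pw : P w = 0 by rewrite -Cw P_coproj.
    have -> : p - coproj p = P p by rewrite {1}(P_decomp p) addrK.
    have PP : P (cos t *: coproj p + sin t *: w + P p) = P p.
      by rewrite P_add Plin P_scale P_coproj Pw !scaler0 !add0r Pidem.
    apply/equidistantP; split; first by rewrite PP.
    rewrite coprojE PP addrK !dotvLE cc ww wp (dotvC (coproj p)) wp.
    by transitivity ((cos t ^+ 2 + sin t ^+ 2) / 2); [field|rewrite cos2Dsin2].
  - exact: nv.
have : dotv v (P p) + dotv v (coproj p) = 0.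
  by rewrite -dotvDr -P_decomp dotvC.
move=> /eqP; rewrite addr_eq0 => /eqP vp.
exists (2 * dotv v (P p)); rewrite {1}(P_decomp v) Pv Cv vp.
by apply/rowP => i; rewrite !mxE; ring.
Qed.

Section Inverse.
Context (p : 'rV[R]_4) (s : R) (Sp : equidistant p) (s4 : - (pi / 4) < s < pi / 4).
Let y := cos s *: p + sin s *: (P p - coproj p).

(** Up to a positive factor, the sum and the difference are the cosines of
    s - pi / 4 and s + pi / 4. *)
Lemma cos_sin_pos : [/\ 0 < cos s, 0 < cos s + sin s & 0 < cos s - sin s].
Proof.
have pi0 := pi_gt0 R; move: s4 => /andP[h1 h2].
have c0 : 0 < cos s by apply: cos_gt0_pihalf; apply/andP; split; lra.
have q0 : 0 < cos (pi / 4 : R) by apply: cos_gt0_pihalf; apply/andP; split; lra.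
have pos : 0 < cos (s - pi / 4) by apply: cos_gt0_pihalf; apply/andP; split; lra.
have neg : 0 < cos (s + pi / 4) by apply: cos_gt0_pihalf; apply/andP; split; lra.
move: pos neg; rewrite cosB cosD -cos_pi4 -mulrDl -mulrBl !pmulr_lgt0 //.
Qed.

Lemma P_image : P y = (cos s + sin s) *: P p.
Proof.
rewrite /y P_add !P_scale P_add Pidem -scaleN1r P_scale P_coproj scaler0 addr0.
by rewrite -scalerDl.
Qed.

Lemma coproj_image : coproj y = (cos s - sin s) *: coproj p.
Proof.
rewrite coprojE P_image /y {1}(P_decomp p).
by apply/rowP => i; rewrite !mxE; ring.
Qed.

Lemma enorm_scale (k : R) (x : 'rV[R]_4) : 0 < k -> dotv x x = 1 / 2 ->
  enorm (k *: x) = k / Num.sqrt 2.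
Proof.
move=> k0 xx; rewrite /enorm dotvZl dotvZr xx mulrA -expr2 sqrtrM ?sqr_ge0 //.
by rewrite sqrtr_sqr gtr0_norm // mul1r sqrtrV.
Qed.

Definition foot y : 'rV[R]_4 := (Num.sqrt 2)^-1 *:
  ((enorm (P y))^-1 *: P y + (enorm (coproj y))^-1 *: coproj y).

Definition angle y : R := atan ((enorm (P y) - enorm (coproj y)) /
  (enorm (P y) + enorm (coproj y))).

(** Moving by [s] along the normal rescales the two components of [p] by
    cos s + sin s and cos s - sin s.  Both factors are positive, so normalizing the
    components recovers [p], and the ratio of their difference to their sum is
    tan s. *)
Lemma foot_image : foot y = p /\ angle y = s.
Proof.
have [c0 cp cm] := cos_sin_pos; have [pp cc] := (equidistantP p).1 Sp.
have s2 : Num.sqrt 2 != 0 :> R by rewrite gt_eqF // sqrtr_gt0.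
have eP := enorm_scale cp pp; have eC := enorm_scale cm cc.
split.
  rewrite /foot P_image coproj_image eP eC !scalerA scalerDr !scalerA.
  rewrite {3}(P_decomp p) -[P p in RHS]scale1r -[coproj p in RHS]scale1r.
  by congr (_ *: _ + _ *: _); field; rewrite s2 gt_eqF.
rewrite /angle P_image coproj_image eP eC.
have pi0 := pi_gt0 R; move: s4 => /andP[h1 h2].
rewrite -[RHS](tanK (x := s)); last by rewrite in_itv /=; apply/andP; split; lra.
congr atan; rewrite /tan.
field; rewrite s2 (gt_eqF c0) /=; apply/eqP.
have : cos s + sin s + (cos s - sin s) = 2 * cos s by ring.
lra.
Qed.

End Inverse.

End QuadricNormalMap.

(** * The normal exponential map of the Clifford torus *)

Section QuadricDiffeo.
Context {R : realType} (P : 'rV[R]_4 -> 'rV[R]_4).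
Context (Psym : forall x y, dotv (P x) y = dotv x (P y)).
Context (Pidem : forall x, P (P x) = P x).
Context (Plin : forall s x y, P (s *: x + y) = s *: P x + P y).
Context (Psmooth : forall (V : normedModType R) (U : set V) k (g : V -> 'rV[R]_4),
  open U -> Ck_on k U g -> Ck_on k U (fun x => P (g x))).

(** On a line of normal vectors with a chosen unit vector, the formula of the
    exponential map holds for parameters of either sign, hence extends smoothly
    across zero. *)
Lemma S3_exp_signed (p n : 'rV[R]_4) (s : R) : dotv n n = 1 ->
  enorm (s *: n) = `|s| /\ S3_exp (p, s *: n) = cos s *: p + sin s *: n.
Proof.
move=> n1; have [s0|s0] := leP 0 s; first by rewrite ger0_norm //; exact: S3_exp_scale.
rewrite ltr0_norm //.
have n1' : dotv (- n) (- n) = 1 by rewrite dotvNl dotvNr opprK.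
have s0' : 0 <= - s by rewrite oppr_ge0 ltW.
have [h1 h2] := S3_exp_scale p n1' s0'.
have e : - s *: - n = s *: n by rewrite scalerN scaleNr opprK.
rewrite e in h1 h2; rewrite cosN sinN scalerN scaleNr opprK in h2.
by split.
Qed.

Local Notation coproj := (coproj P).
Local Notation equidistant := (equidistant P).

Definition unit_normal p := P p - coproj p.

Lemma unit_normal_unit p : equidistant p -> dotv (unit_normal p) (unit_normal p) = 1.
Proof.
move=> /(equidistantP Psym Pidem Plin)[pp cc].
rewrite /unit_normal !dotvLE pp cc (dotvC (coproj p)).
by rewrite (dotv_P_coproj Psym Pidem Plin); field.
Qed.

Lemma Ck_on_coproj (V : normedModType R) (U : set V) k (g : V -> 'rV[R]_4) :
  open U -> Ck_on k U g -> Ck_on k U (fun x => coproj (g x)).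
Proof.
move=> oU Cg; have -> : (fun x => coproj (g x)) = (fun x => g x + (-1) *: P (g x)).
  by apply/funext => x; rewrite coprojE scaleN1r.
apply: (Ck_onD oU) => //.
by apply: (Ck_on_scale (a := fun=> -1) oU); [exact: Ck_on_cst|exact: Psmooth].
Qed.

Lemma Ck_on_unit_normal (V : normedModType R) (U : set V) k (g : V -> 'rV[R]_4) :
  open U -> Ck_on k U g -> Ck_on k U (fun x => unit_normal (g x)).
Proof.
move=> oU Cg.
have -> : (fun x => unit_normal (g x)) = (fun x => P (g x) + (-1) *: coproj (g x)).
  by apply/funext => x; rewrite scaleN1r.
apply: (Ck_onD oU); first exact: Psmooth.
by apply: (Ck_on_scale (a := fun=> -1) oU); [exact: Ck_on_cst|exact: Ck_on_coproj].
Qed.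

(** The normal discs of radius pi / 4 sweep out, once, the complement of the two
    great circles in the range and in the kernel of [P]. *)
Lemma equidistant_diffeo :
  diffeo_onto_image (normal_disc_bundle equidistant (pi / 4)) S3_exp.
Proof.
have oT (V : normedModType R) : open [set: V] by exact: openT.
have disc pv : normal_disc_bundle equidistant (pi / 4) pv -> exists s : R,
    [/\ equidistant pv.1, - (pi / 4) < s < pi / 4, pv.2 = s *: unit_normal pv.1 &
        S3_exp pv = cos s *: pv.1 + sin s *: unit_normal pv.1].
  case: pv => p v [nv vr]; have [Sp _ _] := nv.
  have [s vE] := equidistant_normal Psym Pidem Plin nv.
  have m1 := unit_normal_unit Sp; have [es exps] := S3_exp_signed p s m1.
  exists s; split=> //=; last by rewrite vE.
  by move: vr; rewrite /= vE es ltr_norml.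
split.
  move=> pv _.
  pose th (q : 'rV[R]_4 * 'rV[R]_4) := dotv q.2 (unit_normal q.1).
  exists setT, (fun q => cos (th q) *: q.1 + sin (th q) *: unit_normal q.1).
  split=> //.
    move=> k; have oTT := oT ('rV[R]_4 * 'rV[R]_4)%type.
    have C1 : Ck_on k setT (fun q : 'rV[R]_4 * 'rV[R]_4 => q.1).
      by apply: (Ck_on_linear (L := fst) oTT); [move=> q; exact: cvg_fst|exact: Ck_on_id].
    have C2 : Ck_on k setT (fun q : 'rV[R]_4 * 'rV[R]_4 => q.2).
      by apply: (Ck_on_linear (L := snd) oTT); [move=> q; exact: cvg_snd|exact: Ck_on_id].
    have Ca := Ck_on_unit_normal oTT C1.
    have Ct : Ck_on k setT th by exact: (Ck_on_dotv oTT C2 Ca).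
    have [Cc Cs] := Ck_on_cos_sin (R := R) k (oT R).
    apply: (Ck_onD oTT); apply: (Ck_on_scale oTT) => //.
      exact: (Ck_on_comp oTT (I := setT)).
    exact: (Ck_on_comp oTT (I := setT)).
  move=> q _ /disc[s [Sq s4 qE ->]].
  by rewrite /th qE dotvZl unit_normal_unit // mulr1.
exists (fun y => (foot P y, angle P y *: unit_normal (foot P y))).
have inv (p : 'rV[R]_4) (s : R) : equidistant p -> - (pi / 4) < s < pi / 4 ->
    foot P (cos s *: p + sin s *: unit_normal p) = p /\
    angle P (cos s *: p + sin s *: unit_normal p) = s.
  by move=> Sp s4; exact: foot_image.
split=> [pv /disc[s [Sp s4 vE ->]]|_ [pv Apv <-]].
  by have [-> ->] := inv _ _ Sp s4; rewrite -vE -surjective_pairing.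
pose U := [set y | 0 < dotv (P y) (P y)] `&` [set y | 0 < dotv (coproj y) (coproj y)].
have CP k : Ck_on k setT P by apply: (Psmooth (g := id)) => //; exact: Ck_on_id.
have CC k : Ck_on k setT coproj by apply: (Ck_on_coproj (g := id)) => //; exact: Ck_on_id.
have open_pos (g : 'rV[R]_4 -> R) : Ck_on 0 setT g -> open [set y | 0 < g y].
  move=> cg; apply: (@open_comp _ _ g [set t | 0 < t]); last exact: open_gt.
  by move=> y _; exact: cg.
have oU : open U.
  apply: openI; apply: open_pos; apply: (Ck_on_dotv (oT _)).
  - exact: CP.
  - exact: CP.
  - exact: CC.
  - exact: CC.
exists U, (fun y => (foot P y, angle P y *: unit_normal (foot P y))).
split=> //.
  have [s [Sp s4 _ ->]] := disc _ Apv.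
  have [c0 cp cm] := cos_sin_pos s4.
  have [pp cc] := (equidistantP Psym Pidem Plin _).1 Sp.
  split=> /=; rewrite /unit_normal.
    rewrite (P_image Pidem Plin) dotvZl dotvZr pp !mulr_gt0 //.
  by rewrite (coproj_image Pidem Plin) dotvZl dotvZr cc !mulr_gt0.
move=> k.
have CP' : Ck_on k U P by apply: Ck_on_sub (CP k).
have CC' : Ck_on k U coproj by apply: Ck_on_sub (CC k).
have CeP : Ck_on k U (fun y => enorm (P y)).
  by apply: (Ck_on_sqrt oU) => [y []//|]; exact: Ck_on_dotv.
have CeC : Ck_on k U (fun y => enorm (coproj y)).
  by apply: (Ck_on_sqrt oU) => [y []//|]; exact: Ck_on_dotv.
have eP0 y : U y -> 0 < enorm (P y) by move=> [h _]; rewrite sqrtr_gt0.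
have eC0 y : U y -> 0 < enorm (coproj y) by move=> [_ h]; rewrite sqrtr_gt0.
have Cf : Ck_on k U (foot P).
  apply: (Ck_on_scale (a := fun=> (Num.sqrt 2)^-1) oU); first exact: Ck_on_cst.
  apply: (Ck_onD oU); apply: (Ck_on_scale oU) => //; apply: (Ck_onV oU) => // y /[dup].
    by move=> /eP0 h _; rewrite gt_eqF.
  by move=> /eC0 h _; rewrite gt_eqF.
apply: (Ck_on_pair oU) => //.
apply: (Ck_on_scale oU); last exact: Ck_on_unit_normal.
apply: (Ck_on_comp oU (I := setT)) => //; first exact: Ck_on_atan.
apply: (Ck_onM oU).
  by apply: (Ck_onD oU) => //; apply: (Ck_onN oU).
apply: (Ck_onV oU) => [y Uy|]; first by rewrite gt_eqF // addr_gt0 ?eP0 ?eC0.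
exact: Ck_onD.
Qed.

End QuadricDiffeo.

(** * Isometries of the sphere and the main theorem *)

Section CliffordConverse.
Context {R : realType}.

Lemma equidistant_focal_ge (P : 'rV[R]_4 -> 'rV[R]_4) :
  (forall x y, dotv (P x) y = dotv x (P y)) -> (forall x, P (P x) = P x) ->
  (forall s x y, P (s *: x + y) = s *: P x + P y) ->
  (forall (V : normedModType R) (U : set V) k (g : V -> 'rV[R]_4),
    open U -> Ck_on k U g -> Ck_on k U (fun x => P (g x))) ->
  ((pi / 4)%:E <= focal_radius (equidistant P))%E.
Proof.
move=> Psym Pidem Plin Psmooth; apply: ereal_sup_ubound; exists (pi / 4) => //.
by split; [rewrite divr_gt0 ?pi_gt0|exact: equidistant_diffeo].
Qed.

Definition plane_proj (b : 'I_4 -> 'rV[R]_4) y :=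
  dotv y (b 0) *: b 0 + dotv y (b 1) *: b 1.

Lemma quadric_focal_ge (b : 'I_4 -> 'rV[R]_4) (Sigma : set 'rV[R]_4) :
  orthonormal4 b ->
  (forall x, Sigma x <-> dotv x x = 1 /\ clifford_form (basis_coord b x) = 0) ->
  ((pi / 4)%:E <= focal_radius Sigma)%E.
Proof.
move=> ob SE.
have b00 := ob 0 0; have b11 := ob 1 1; have b01 := ob 0 1; have b10 := ob 1 0.
rewrite /= in b00 b11 b01 b10.
have PP y : dotv (plane_proj b y) (plane_proj b y) =
    dotv y (b 0) ^+ 2 + dotv y (b 1) ^+ 2.
  by rewrite /plane_proj !dotvLE b00 b11 b01 b10; ring.
have -> : Sigma = equidistant (plane_proj b).
  apply/seteqP; split=> x.
    move=> /SE[x1 hx]; split=> //; rewrite PP.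
    have := basis_coord_dotv x x ob; rewrite x1 dotvE.
    by move: hx; rewrite /clifford_form !mxE; lra.
  move=> [x1 hx]; apply/SE; split=> //; rewrite PP in hx.
  have := basis_coord_dotv x x ob; rewrite x1 dotvE.
  by rewrite /clifford_form !mxE; lra.
apply: equidistant_focal_ge.
- by move=> x y; rewrite /plane_proj !dotvLE !(dotvC _ y); ring.
- move=> x; rewrite {1}/plane_proj; congr (_ *: _ + _ *: _).
    by rewrite /plane_proj !dotvLE b00 b10; ring.
  by rewrite /plane_proj !dotvLE b11 b01; ring.
- move=> s x y; rewrite /plane_proj !(dotvDl, dotvZl).
  by apply/rowP => i; rewrite !mxE; ring.
- move=> V U k g oU Cg.
  by apply: (Ck_onD oU); apply: (Ck_onZl _ oU); apply: (Ck_on_dotv (g := fun=> _) oU Cg);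
    exact: Ck_on_cst.
Qed.

(** An isometry of the sphere is given by the coordinates in an orthonormal
    basis: the preimage of the standard basis. *)
Lemma S3_isometry_basis (phi : 'rV[R]_4 -> 'rV[R]_4) : S3_isometry phi ->
  exists b, orthonormal4 b /\ forall x, dotv x x = 1 -> phi x = basis_coord b x.
Proof.
move=> [phiS phid].
have phi1 x : dotv x x = 1 -> dotv (phi x) (phi x) = 1.
  by move=> /S3E x1; apply/S3E; rewrite -phiS; exists x.
have dot x y : dotv x x = 1 -> dotv y y = 1 -> dotv (phi x) (phi y) = dotv x y.
  move=> x1 y1; have := phid x y ((S3E _).2 x1) ((S3E _).2 y1); rewrite /S3_dist => h.
  have in1 : dotv x y \in `[-1, 1] by rewrite in_itv; exact: dotv_unit_le1.
  have in2 : dotv (phi x) (phi y) \in `[-1, 1].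
    by rewrite in_itv; apply: dotv_unit_le1; exact: phi1.
  by rewrite -[LHS](acosK in2) h acosK.
have dd (i : 'I_4) z : dotv z (delta_mx 0 i) = z 0 i.
  rewrite /dotv (bigD1 i) //= mxE !eqxx mulr1 big1 ?addr0 // => j ji.
  by rewrite mxE (negPf ji) andbF mulr0.
have /choice[b bP] (i : 'I_4) : exists x, dotv x x = 1 /\ phi x = delta_mx 0 i.
  have : S3 (delta_mx 0 i : 'rV[R]_4) by apply/S3E; rewrite dd mxE !eqxx.
  by rewrite -phiS => -[x /S3E x1 xi]; exists x.
exists b; split.
  move=> i j; have [bi pi] := bP i; have [bj pj] := bP j.
  by rewrite -dot // pi pj dd mxE eqxx /= eq_sym.
move=> x x1; apply/rowP => i; rewrite !mxE -dd; have [bi <-] := bP i.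
exact: dot.
Qed.

(** In the basis attached to the isometry, the torus is the set of points of the
    sphere equidistant from two orthogonal coordinate planes. *)
Lemma clifford_focal_ge (Sigma : set 'rV[R]_4) phi :
  (forall x, Sigma x -> dotv x x = 1) -> S3_isometry phi ->
  phi @` Sigma = clifford_torus -> ((pi / 4)%:E <= focal_radius Sigma)%E.
Proof.
move=> S1 /S3_isometry_basis[b [ob phib]] img.
apply: (quadric_focal_ge ob) => x; split=> [Sx|[x1 hx]].
  have x1 := S1 _ Sx; split=> //.
  have : clifford_torus (phi x) by rewrite -img; exists x.
  by move=> /clifford_torusE[_]; rewrite phib.
have : clifford_torus (basis_coord b x).
  by apply/clifford_torusE; rewrite basis_coord_dotv.
rewrite -img => -[y Sy]; rewrite phib ?S1 // => xy.
suff -> : x = y by [].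
apply: dotv_unit_eq => //; first exact: S1.
by rewrite -(basis_coord_dotv x y ob) xy basis_coord_dotv.
Qed.

End CliffordConverse.

Theorem theorem1p6 (R : realType) (Sigma : set 'rV[R]_4)
    (hSigma : embedded_torus Sigma) :
  (focal_radius Sigma <= (pi / 4)%:E)%E /\
  (focal_radius Sigma = (pi / 4)%:E <->
   exists phi : 'rV[R]_4 -> 'rV[R]_4,
     S3_isometry phi /\ phi @` Sigma = clifford_torus).
Proof.
have [f [hf <-]] := hSigma.
split; first exact: focal_le.
split=> [foc|[phi [iso img]]]; first by apply: (torus_clifford hf); rewrite foc.
apply/eqP; rewrite eq_le focal_le //=; apply: clifford_focal_ge iso img.
by move=> _ [x _ <-]; exact: torus_unit.
Qed.
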